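(* Let $B\subset\mathbb{R}^2$ be the open unit ball, $M\in\mathbb{N}$, $M\ge1$, and let $\rho$ be as described in the context. Let $u\in\mathcal{A}_r^M$ be of the form $u(x)=r(R)e_R(M\theta)$, where $r\in C([0,1])\cap C^\infty((0,1])$ solves $$\frac{M^2r}{R}=\dot r+R\ddot r+M\rho''(d)\,\dot d\,r\quad\text{in }(0,1),\qquad r(0)=0,\quad r(1)=1,\qquad d(R)=\frac{M\,r(R)\,\dot r(R)}{R}.$$ Then $u$ solves the Euler–Lagrange equation weakly, i.e. $$\int_B\nabla_\xi W(\nabla u)\cdot\nabla\varphi\,dx=0\qquad\text{for all }\varphi\in C_c^\infty(B,\mathbb{R}^2),$$ where $W(\xi)=\frac12|\xi|^2+\rho(\det\xi)$.
   Context: Dots denote derivatives with respect to $R$; $(R,\theta)$ are polar coordinates and $e_R(M\theta)=(\cos M\theta,\sin M\theta)^T$. $\mathcal{A}_r^M=\{u\in W^{1,2}(B,\mathbb{R}^2):\exists\, r:[0,1]\to\mathbb{R}\text{ with }u(x)=r(R)e_R(M\theta)\text{ and }r(1)=1\}$. The function $\rho\in C^\infty(\mathbb{R})$ is given by $\rho(s)=0$ for $s\le 0$, $\rho(s)=\rho_1(s)$ for $0\le s\le s_0$, and $\rho(s)=\gamma s+\kappa$ for $s\ge s_0$, where $0<\gamma<\infty$, $s_0\ge0$, $\kappa\ge-\gamma s_0$ are constants and $\rho_1:[0,s_0]\to\mathbb{R}$ is smooth and convex with $\rho_1(0)=0$, $\rho_1(s_0)=\gamma s_0+\kappa$, the pieces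 being connected so that $\rho$ is smooth on $\mathbb{R}$; $\rho$ is convex on $\mathbb{R}$. $\nabla_\xi W(\xi)=\xi+\rho'(\det\xi)\,\mathrm{cof}\,\xi$, with $\mathrm{cof}\,A=\begin{pmatrix}a_{22}&-a_{21}\\-a_{12}&a_{11}\end{pmatrix}$. *)

(* Defs.v *)
From HB Require Import structures.
From mathcomp Require Import all_boot all_order all_algebra.
From mathcomp Require Import all_classical all_reals all_analysis.

Set Implicit Arguments.
Unset Strict Implicit.
Unset Printing Implicit Defensive.

Import Order.TTheory GRing.Theory Num.Theory.
Import numFieldNormedType.Exports.

Local Open Scope ring_scope.
Local Open Scope classical_set_scope.

Section OneVariable.
Variable R : realType.

(* Smoothness on a set that need not be open, such as ]0, 1] or [0, s0]: the
   restriction of a function that is smooth on an open neighbourhood. *)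
Definition smooth_on (A : set R) (f : R -> R) : Prop :=
  exists (U : set R) (g : R -> R),
    [/\ open U, A `<=` U, {in A, f =1 g} &
        forall (n : nat) (x : R), U x -> derivable (derive1n n g) x 1].

Definition smooth (f : R -> R) : Prop :=
  forall (n : nat) (x : R), derivable (derive1n n f) x 1.

Definition admissible_rho (gamma s0 kappa : R) (rho1 rho : R -> R) : Prop :=
  [/\ [/\ 0 < gamma, 0 <= s0 & - gamma * s0 <= kappa],
      [/\ smooth_on `[0, s0] rho1, convex_function `[0, s0] rho1,
          rho1 0 = 0 & rho1 s0 = gamma * s0 + kappa],
      [/\ forall s : R, s <= 0 -> rho s = 0,
          forall s : R, 0 <= s <= s0 -> rho s = rho1 s &
          forall s : R, s0 <= s -> rho s = gamma * s + kappa],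
      smooth rho &
      convex_function setT rho].

Definition radial_det (M : nat) (r : R -> R) (t : R) : R :=
  M%:R * r t * derive1 r t / t.

Definition radial_ode (rho : R -> R) (M : nat) (r : R -> R) (t : R) : Prop :=
  let d := radial_det M r in
  M%:R ^+ 2 * r t / t =
    derive1 r t + t * derive1n 2 r t +
    M%:R * derive1n 2 rho (d t) * derive1 d t * r t.

End OneVariable.

Section Plane.
Variable R : realType.

(* The library's [ball] on a product is the one of the sup norm. *)
Definition unit_disc : set (R * R) := [set x | x.1 ^+ 2 + x.2 ^+ 2 < 1].

Definition area := (@lebesgue_measure R \x @lebesgue_measure R)%E.

Definition axis (j : 'I_2) : R * R := if j == ord0 then (1, 0) else (0, 1).

Definition partial (j : 'I_2) (f : R * R -> R) (x : R * R) : R :=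
  'D_(axis j) f x.

Definition smooth2 (f : R * R -> R) : Prop :=
  forall s : seq 'I_2, let g := foldr partial f s in
  continuous g /\ forall (j : 'I_2) (x : R * R), derivable g x (axis j).

Definition test_function (O : set (R * R)) (f : R * R -> R) : Prop :=
  smooth2 f /\
  exists K : set (R * R), [/\ compact K, K `<=` O & forall x, ~ K x -> f x = 0].

Definition test_field (O : set (R * R)) (phi : R * R -> 'cV[R]_2) : Prop :=
  forall i : 'I_2, test_function O (fun x => phi x i 0).

Definition grad (phi : R * R -> 'cV[R]_2) (x : R * R) : 'M[R]_2 :=
  \matrix_(i, j) partial j (fun y => phi y i 0) x.

Definition square_integrable (O : set (R * R)) (f : R * R -> R) : Prop :=
  measurable_fun O f /\ (\int[area]_(x in O) (f x ^+ 2)%:E < +oo)%E.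

(* Square integrability is part of the notion, so that the integrals below are
   finite and [Du] is determined almost everywhere by [u] in W^{1,2}. *)
Definition weak_gradient (O : set (R * R)) (u : R * R -> 'cV[R]_2)
    (Du : R * R -> 'M[R]_2) : Prop :=
  forall i j : 'I_2,
    square_integrable O (fun x => Du x i j) /\
    forall f : R * R -> R, test_function O f ->
      (\int[area]_(x in O) (u x i 0 * partial j f x)%:E =
       - \int[area]_(x in O) (Du x i j * f x)%:E)%E.

Definition W12 (O : set (R * R)) (u : R * R -> 'cV[R]_2) : Prop :=
  (forall i : 'I_2, square_integrable O (fun x => u x i 0)) /\
  exists Du : R * R -> 'M[R]_2, weak_gradient O u Du.

Definition e_R (t : R) : 'cV[R]_2 :=
  \col_i (if i == ord0 then cos t else sin t).

(* Elements of W^{1,2} are only defined almost everywhere, hence so is this;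
   in particular the origin, where the angle is undefined, plays no role. *)
Definition radial_form (M : nat) (r : R -> R) (u : R * R -> 'cV[R]_2) : Prop :=
  {ae area, forall x : R * R, unit_disc x ->
     forall t theta : R, 0 < t -> x = (t * cos theta, t * sin theta) ->
       u x = r t *: e_R (M%:R * theta)}.

Definition admissible_map (M : nat) (u : R * R -> 'cV[R]_2) : Prop :=
  W12 unit_disc u /\ exists r : R -> R, radial_form M r u /\ r 1 = 1.

End Plane.

Section Energy.
Variable R : realType.

Definition mxdot (A B : 'M[R]_2) : R := \sum_i \sum_j A i j * B i j.

Definition stored_energy (rho : R -> R) (xi : 'M[R]_2) : R :=
  2^-1 * mxdot xi xi + rho (\det xi).

Definition mxgrad (W : 'M[R]_2 -> R) (xi : 'M[R]_2) : 'M[R]_2 :=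
  \matrix_(i, j) 'D_(delta_mx i j) W xi.

End Energy.

(* Main.v *)
Require Import Defs.
From mathcomp Require Import all_boot all_order all_algebra.
From mathcomp Require Import all_classical all_reals all_analysis.
From mathcomp Require Import measurable_realfun.
From mathcomp Require Import ring lra.
Set Implicit Arguments.
Unset Strict Implicit.
Unset Printing Implicit Defensive.
Import Order.TTheory GRing.Theory Num.Theory.
Import numFieldNormedType.Exports.
Local Open Scope ring_scope.
Local Open Scope classical_set_scope.

(** Why the theorem holds.  Away from the origin the map is the classical
    radial map with components r(R) cos (M theta) and r(R) sin (M theta).  Its
    weak gradient is therefore the classical gradient almost everywhere
    ([radial_weak_gradient]), the determinant of which is d(R).  Each row of
    the stress xi + rho'(det xi) cof xi is then a continuously differentiable
    field on the punctured disc.  Its divergence has two parts: the Laplacian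
    of the component, and the derivative of rho'(d) in the direction of the
    cofactor row, because the rows of a cofactor matrix of a gradient are
    divergence free.  Both are multiples of the same trigonometric function,
    and the sum of the two coefficients vanishes by the radial equation
    ([radial_stress_solenoidal]).

    This gives the Euler-Lagrange equation for test functions that vanish near
    the origin.  For the others the idea is that a point has zero capacity in
    the plane.  The derivative of rho is bounded
    ([admissible_rho_derive_bounded]), so the stress is square integrable as the
    gradient is.  Test functions are multiplied by radial cutoffs that vanish
    near the origin.  The gradient of the n-th cutoff has size of order n and
    lives in a square with side of order 1/n, so its energy is bounded, while
    the energy of the stress in that square tends to zero; the error term
    tends to zero ([removable_origin]).

    The identification of the weak gradient rests on the fundamental lemma of
    the calculus of variations.  Tensor products of smooth plateau functions
    approximate the indicators of boxes ([plateau], [smooth2_tensor]); a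
    function that is orthogonal to them has zero integral over every box, hence
    over every measurable subset of a box ([orthogonal_box_ae0]).

    The angle never appears as a function on the plane.  The functions
    cos (M theta) and sin (M theta) are defined by the addition formulas in
    terms of x.1 / R and x.2 / R ([cosn], [sinn]).  They satisfy a closed
    system of differential equations ([angular]), which turns every
    computation into a polynomial identity. *)

(** * Open sets of the plane as countable unions of boxes *)

Section PlaneTopology.
Variable R : realType.
Implicit Types (O : set (R * R)) (x : R * R).

Definition obox (a b c d : R) : set (R * R) := `]a, b[ `*` `]c, d[.
Definition cbox (a b c d : R) : set (R * R) := `[a, b] `*` `[c, d].

Lemma measurable_obox a b c d : measurable (obox a b c d).
Proof. by apply: measurableX; exact: measurable_itv. Qed.

Lemma measurable_cbox a b c d : measurable (cbox a b c d).
Proof. by apply: measurableX; exact: measurable_itv. Qed.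

Lemma sub_obox_cbox a b c d : obox a b c d `<=` cbox a b c d.
Proof.
by move=> x [/= h1 h2]; split; [exact: (subset_itv_oo_cc h1)|
  exact: (subset_itv_oo_cc h2)].
Qed.

(** Rational corners, so that countably many boxes suffice. The closed box
    stays in [O]: integrals over a box then involve functions that are
    bounded there. *)
Lemma open_rat_box O x : open O -> O x ->
  exists q : rat * rat * rat * rat,
    obox (ratr q.1.1.1) (ratr q.1.1.2) (ratr q.1.2) (ratr q.2) x /\
    cbox (ratr q.1.1.1) (ratr q.1.1.2) (ratr q.1.2) (ratr q.2) `<=` O.
Proof.
move=> oO Ox.
have /nbhs_ballP[e /= e0 eO] : nbhs x O by exact: open_nbhs_nbhs.
have lt1 (t : R) : t - e < t by rewrite ltrBlDr ltrDl.
have lt2 (t : R) : t < t + e by rewrite ltrDl.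
have [q1] := rat_in_itvoo (lt1 x.1); rewrite in_itv /= => /andP[q1l q1r].
have [q2] := rat_in_itvoo (lt2 x.1); rewrite in_itv /= => /andP[q2l q2r].
have [q3] := rat_in_itvoo (lt1 x.2); rewrite in_itv /= => /andP[q3l q3r].
have [q4] := rat_in_itvoo (lt2 x.2); rewrite in_itv /= => /andP[q4l q4r].
exists (q1, q2, q3, q4) => /=; split.
  by split; rewrite /= in_itv /= ?q1r ?q2l ?q3r ?q4l.
move=> y [/=]; rewrite !in_itv /= => /andP[y1 y2] /andP[y3 y4]; apply: eO.
by split; rewrite /ball /= ltr_distlC; apply/andP; split; lra.
Qed.

(** The plane is second countable, in a form that serves both measurability
    and the localisation of statements that hold almost everywhere. *)
Lemma open_bigcup_box O : open O ->
  exists B : nat -> R * R * R * R,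
    (forall n, cbox (B n).1.1.1 (B n).1.1.2 (B n).1.2 (B n).2 `<=` O) /\
    O = \bigcup_n obox (B n).1.1.1 (B n).1.1.2 (B n).1.2 (B n).2.
Proof.
move=> oO.
pose good (q : rat * rat * rat * rat) :=
  cbox (ratr q.1.1.1) (ratr q.1.1.2) (ratr q.1.2) (ratr q.2) `<=` O.
(* The value (1, 0, 1, 0) stands for an empty box, for the codes that do not
   denote a good box. *)
pose B n : R * R * R * R :=
  if (unpickle n : option (rat * rat * rat * rat)) is Some q then
    if pselect (good q) then
      (ratr q.1.1.1, ratr q.1.1.2, ratr q.1.2, ratr q.2) else (1, 0, 1, 0)
  else (1, 0, 1, 0).
have BO n : cbox (B n).1.1.1 (B n).1.1.2 (B n).1.2 (B n).2 `<=` O.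
  have empty : cbox 1 0 1 0 `<=` O.
    by move=> y [/=]; rewrite in_itv /= => /andP[h1 h2]; lra.
  by rewrite /B; case: unpickle => [q|//]; case: pselect.
exists B; split=> //; apply/seteqP; split=> [x Ox|x [n _ /sub_obox_cbox]]; last first.
  exact: BO.
have [q [qx qO]] := open_rat_box oO Ox.
exists (pickle q) => //; rewrite /B pickleK; case: pselect => //=.
Qed.

Lemma open_measurable2 O : open O -> measurable O.
Proof.
move=> /open_bigcup_box[B [_ ->]].
by apply: bigcup_measurable => n _; exact: measurable_obox.
Qed.

Lemma measurable_fun_continuous_on O (f : R * R -> R) : open O ->
  (forall x, O x -> {for x, continuous f}) -> measurable_fun O f.
Proof.
move=> oO cf; apply: (@measurability _ _ _ _ _ _ (@RGenOpens.G R)).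
  exact: RGenOpens.measurableE.
move=> _ [_ [a [b ->]] <-]; apply: open_measurable2.
rewrite openE => x [Ox fx].
have := cf x Ox => /(_ `]a, b[%classic) H.
apply: filterI; first exact: open_nbhs_nbhs.
by apply: H; apply: open_nbhs_nbhs; split => //; exact: interval_open.
Qed.

End PlaneTopology.

(** * Continuously differentiable functions on open sets of the plane *)

Section PlaneCalculus.
Variable R : realType.
Implicit Types (O : set (R * R)) (f g : R * R -> R) (x : R * R).

Definition e1 : R * R := axis R ord0.
Definition e2 : R * R := axis R ord_max.

(** The partial derivatives are carried along explicitly instead of being
    extracted from [f]: the closure lemmas below then compute the derivatives
    of a compound expression while they prove that it is continuously
    differentiable. *)
Definition C1_on O f f1 f2 := forall x, O x ->
  [/\ {for x, continuous f}, {for x, continuous f1}, {for x, continuous f2},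
      is_derive x e1 f (f1 x) & is_derive x e2 f (f2 x)].

Lemma line_e1 (h : R) x : h *: e1 + x = (h + x.1, x.2).
Proof.
rewrite /e1 /axis eqxx; case: x => a b.
by congr (_, _) => /=; rewrite /GRing.scale/= ?mulr1 ?mulr0 ?add0r.
Qed.

Lemma line_e2 (h : R) x : h *: e2 + x = (x.1, h + x.2).
Proof.
rewrite /e2 /axis /=; case: x => a b.
by congr (_, _) => /=; rewrite /GRing.scale/= ?mulr1 ?mulr0 ?add0r.
Qed.

(** Directional derivatives only see the line, so that every fact about them
    is a fact about functions of one real variable. *)
Lemma is_derive_line (V : normedModType R) (f : V -> R) (x v : V) (df : R) :
  is_derive x v f df <-> is_derive (0 : R) 1 (fun t : R => f (t *: v + x)) df.
Proof.
have E : (fun h : R => h^-1 *: ((f \o shift x) (h *: v) - f x)) =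
  (fun h : R => h^-1 *: (((fun t : R => f (t *: v + x)) \o shift 0) (h *: 1) -
    f (0 *: v + x))).
  by apply/funext => h /=; rewrite scale0r add0r addr0 /GRing.scale /= mulr1.
split=> -[d1 d2]; split.
- by move: d1; rewrite /derivable E.
- by move: d2; rewrite /derive E.
- by rewrite /derivable E.
- by rewrite /derive E.
Qed.

Lemma is_derive_slice1 f x df :
  is_derive x e1 f df <-> is_derive x.1 1 (fun t => f (t, x.2)) df.
Proof.
rewrite is_derive_line (is_derive_line _ x.1).
rewrite (_ : (fun t : R => f (t *: e1 + x)) = (fun t => f (t *: 1 + x.1, x.2)))//.
by apply/funext => t; rewrite line_e1 /GRing.scale /= mulr1.
Qed.

Lemma is_derive_slice2 f x df :
  is_derive x e2 f df <-> is_derive x.2 1 (fun t => f (x.1, t)) df.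
Proof.
rewrite is_derive_line (is_derive_line _ x.2).
rewrite (_ : (fun t : R => f (t *: e2 + x)) = (fun t => f (x.1, t *: 1 + x.2)))//.
by apply/funext => t; rewrite line_e2 /GRing.scale /= mulr1.
Qed.

(** The chain rule for an outer function of one real variable needs only the
    derivative of the inner one along a single direction. *)
Lemma is_derive_comp_dir (V : normedModType R) (h : R -> R) (f : V -> R)
    (x v : V) (dh df : R) :
  is_derive (f x) 1 h dh -> is_derive x v f df ->
  is_derive x v (fun y => h (f y)) (dh * df).
Proof.
move=> hh /is_derive_line hf; apply/is_derive_line.
have E : f x = f (0 *: v + x) by rewrite scale0r add0r.
rewrite E in hh.
exact: (@is_derive1_comp _ h (fun t : R => f (t *: v + x)) 0).
Qed.

(** Besides replacing functions by equal ones, this is how the derivatives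
    computed by the closure lemmas are brought into a chosen form. *)
Lemma C1_ext O f g f1 f2 g1 g2 : open O ->
  (forall x, O x -> f x = g x) -> (forall x, O x -> f1 x = g1 x) ->
  (forall x, O x -> f2 x = g2 x) -> C1_on O f f1 f2 -> C1_on O g g1 g2.
Proof.
move=> oO fg fg1 fg2 C x Ox; have [c c1 c2 d1 d2] := C x Ox.
have nO : \forall y \near x, O y by exact: open_nbhs_nbhs.
have cont u v : (forall x, O x -> u x = v x) -> {for x, continuous u} ->
    {for x, continuous v}.
  move=> uv cu; change (v y @[y --> x] --> v x); rewrite -(uv _ Ox).
  apply: cvg_trans cu; apply: near_eq_cvg.
  by apply: filterS nO => y Oy; rewrite uv.
have der v df dg : df = dg -> is_derive x v f df -> is_derive x v g dg.
  move=> -> ; apply: near_eq_is_derive.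
  by apply: filterS nO => y Oy; rewrite fg.
split; [exact: cont c|exact: cont c1|exact: cont c2| |].
- by apply: der d1; exact: fg1.
- by apply: der d2; exact: fg2.
Qed.

Lemma C1_sub O O' f f1 f2 : O' `<=` O -> C1_on O f f1 f2 -> C1_on O' f f1 f2.
Proof. by move=> OO C x Ox; apply: C; exact: OO. Qed.

Lemma C1_cst O (k : R) : C1_on O (fun=> k) (fun=> 0) (fun=> 0).
Proof. by move=> x Ox; split; try exact: cvg_cst; exact: is_derive_cst. Qed.

Lemma C1_fst O : C1_on O fst (fun=> 1) (fun=> 0).
Proof.
move=> x Ox; split; try exact: cvg_cst; try exact: cvg_fst.
- by apply/is_derive_slice1 => /=; exact: is_derive_id.
- by apply/is_derive_slice2 => /=; exact: is_derive_cst.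
Qed.

Lemma C1_snd O : C1_on O snd (fun=> 0) (fun=> 1).
Proof.
move=> x Ox; split; try exact: cvg_cst; try exact: cvg_snd.
- by apply/is_derive_slice1 => /=; exact: is_derive_cst.
- by apply/is_derive_slice2 => /=; exact: is_derive_id.
Qed.

Lemma C1_add O f g f1 f2 g1 g2 : C1_on O f f1 f2 -> C1_on O g g1 g2 ->
  C1_on O (fun x => f x + g x) (fun x => f1 x + g1 x) (fun x => f2 x + g2 x).
Proof.
move=> F G x Ox; have [? ? ? ? ?] := F x Ox; have [? ? ? ? ?] := G x Ox.
by split; first [exact: continuousD | exact: is_deriveD].
Qed.

Lemma C1_opp O f f1 f2 : C1_on O f f1 f2 ->
  C1_on O (fun x => - f x) (fun x => - f1 x) (fun x => - f2 x).
Proof.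
move=> F x Ox; have [? ? ? ? ?] := F x Ox.
by split; first [exact: continuousN | exact: is_deriveN].
Qed.

Lemma C1_mul O f g f1 f2 g1 g2 : C1_on O f f1 f2 -> C1_on O g g1 g2 ->
  C1_on O (fun x => f x * g x) (fun x => f1 x * g x + f x * g1 x)
    (fun x => f2 x * g x + f x * g2 x).
Proof.
move=> F G x Ox; have [? ? ? ? ?] := F x Ox; have [? ? ? ? ?] := G x Ox.
have eqd u v : v * g x + f x * u = f x *: u + g x *: v.
  by rewrite /GRing.scale /= [v * _]mulrC addrC.
split; try (by apply: continuousD; exact: continuousM); first exact: continuousM.
- by rewrite eqd; exact: is_deriveM.
- by rewrite eqd; exact: is_deriveM.
Qed.

Lemma C1_comp O (I : set R) (h h' : R -> R) f f1 f2 :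
  (forall t, I t -> is_derive t 1 h (h' t)) ->
  (forall t, I t -> {for t, continuous h'}) ->
  (forall x, O x -> I (f x)) ->
  C1_on O f f1 f2 ->
  C1_on O (fun x => h (f x)) (fun x => h' (f x) * f1 x)
    (fun x => h' (f x) * f2 x).
Proof.
move=> dh ch fI F x Ox; have [cf c1 c2 d1 d2] := F x Ox.
have If := fI x Ox; have dhx := dh _ If.
have ch' : {for x, continuous (fun x => h' (f x))}.
  by apply: (@continuous_comp _ _ _ f h') => //; exact: ch.
split; try (by apply: continuousM).
- apply: (@continuous_comp _ _ _ f h) => //.
  by apply/differentiable_continuous/derivable1_diffP; exact: ex_derive.
- exact: is_derive_comp_dir.
- exact: is_derive_comp_dir.
Qed.

Lemma C1_inv O f f1 f2 : (forall x, O x -> f x != 0) -> C1_on O f f1 f2 ->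
  C1_on O (fun x => (f x)^-1) (fun x => - (f x) ^- 2 * f1 x)
    (fun x => - (f x) ^- 2 * f2 x).
Proof.
move=> f0; apply: (@C1_comp O [set t | t != 0] (fun t => t^-1) (fun t => - t ^- 2)).
- move=> t /= t0; apply: is_derive_eq.
    by apply: is_deriveV.
  by rewrite /GRing.scale /= mulr1.
- move=> t /= t0; apply: continuousN; apply: continuousV.
    by rewrite expf_neq0.
  exact: exprn_continuous.
- exact: f0.
Qed.

End PlaneCalculus.

(** * Integrals of partial derivatives of compactly supported functions *)

Section PlaneIntegration.
Variable R : realType.

Lemma pair_continuous1 (b : R) : continuous (fun t : R => (t, b)).
Proof.
by move=> t; apply: (@cvg_pair _ _ _ (nbhs t) (nbhs t) (nbhs b)) => //;
  exact: cvg_cst.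
Qed.

Lemma pair_continuous2 (a : R) : continuous (fun t : R => (a, t)).
Proof.
by move=> t; apply: (@cvg_pair _ _ _ (nbhs t) (nbhs a) (nbhs t)) => //;
  exact: cvg_cst.
Qed.

Implicit Types (O K : set (R * R)) (f g : R * R -> R) (x : R * R).

Lemma area_cbox_lty (a b c d : R) : (@area R (cbox a b c d) < +oo)%E.
Proof.
rewrite /area /cbox product_measure1E; [|exact: measurable_itv..].
have lty (p q : R) : (@lebesgue_measure R `[p, q]%classic < +oo)%E.
  by rewrite lebesgue_measure_itv /=; case: ifPn => _; rewrite ltry.
apply: lte_mul_pinfty; [exact: measure_ge0| |exact: lty].
by rewrite ge0_fin_numE; [exact: lty|exact: measure_ge0].
Qed.

Lemma compact_sub_obox K : compact K ->
  exists2 L : R, 0 < L & K `<=` obox (- L) L (- L) L.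
Proof.
move=> /compact_bounded[M [_ HM]]; exists (`|M| + 2); first by rewrite ltr_wpDl.
move=> x Kx; have : `|x| <= `|M| + 1.
  by apply: HM => //; rewrite (le_lt_trans (ler_norm M))// ltrDl.
rewrite prod_normE ge_max => /andP[h1 h2].
by split; rewrite /= in_itv /= -ltr_norml; lra.
Qed.

Lemma compact_fun_bounded K f : compact K -> (forall x, K x -> {for x, continuous f}) ->
  exists2 B : R, 0 <= B & forall x, K x -> `|f x| <= B.
Proof.
move=> cK cf.
have /compact_bounded[M [_ HM]] : compact [set f x | x in K].
  apply: continuous_compact => //; apply: continuous_in_subspaceT => x.
  by rewrite inE; exact: cf.
exists (`|M| + 1); first by rewrite addr_ge0.
move=> x Kx; apply: HM; last by exists x.
by rewrite (le_lt_trans (ler_norm M))// ltrDl.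
Qed.

Lemma compact_cbox (a b c d : R) : compact (cbox a b c d).
Proof. by apply: compact_setX; exact: segment_compact. Qed.

Lemma plane_hausdorff : hausdorff_space (R * R)%type.
Proof. exact: norm_hausdorff. Qed.

Lemma compact_support_integrable K f : continuous f -> compact K ->
  (forall x, ~ K x -> f x = 0) -> (@area R).-integrable setT (EFin \o f).
Proof.
move=> cf cK f0; have [L L0 KL] := compact_sub_obox cK.
have mD := @measurable_cbox R (- L) L (- L) L.
rewrite (_ : EFin \o f = (EFin \o f) \_ (cbox (- L) L (- L) L)).
  apply/(@integrable_mkcond _ _ _ (@area R) _ (EFin \o f) mD).
  apply: measurable_bounded_integrable => //.
  - exact: area_cbox_lty.
  - apply: (measurable_funS measurableT) => //.
    by apply: measurable_fun_continuous_on; [exact: openT|move=> x _; exact: cf].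
  - have [B _ HB] := compact_fun_bounded (@compact_cbox (- L) L (- L) L) (fun x _ => cf x).
    exists B; split; first exact: num_real.
    by move=> y By x Dx; exact: le_trans (HB x Dx) (ltW By).
apply/funext => x; rewrite patchE; case: ifPn => // /negP.
rewrite inE => xD /=; rewrite f0// => Kx; apply: xD.
by apply: sub_obox_cbox; exact: KL.
Qed.

Lemma derive_off_support K f (v : R * R) x df : compact K ->
  (forall x, ~ K x -> f x = 0) -> is_derive x v f df -> ~ K x -> df = 0.
Proof.
move=> cK f0 df1 Kx.
have oK : open (~` K).
  by apply: closed_openC; apply: compact_closed => //; exact: plane_hausdorff.
have /near_eq_is_derive/(_ df1) : \near x, f x = (fun=> 0) x.
  have : nbhs x (~` K) by exact: open_nbhs_nbhs.
  by apply: filterS => y; exact: f0.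
by move=> /@derive_val <-; rewrite derive_cst.
Qed.

(** The fundamental theorem of calculus on [-L, L], where both end values of
    [F] vanish. *)
Lemma integral_derive_line (F F' : R -> R) (L : R) : 0 < L ->
  (forall t : R, is_derive t 1 F (F' t)) -> continuous F' ->
  (forall t, ~ `]- L, L[%classic t -> F t = 0) ->
  (forall t, ~ `[- L, L]%classic t -> F' t = 0) ->
  (\int[@lebesgue_measure R]_t (F' t)%:E = 0)%E.
Proof.
move=> L0 dF cF' F0 F'0.
have cF : continuous F.
  move=> t; apply/differentiable_continuous/derivable1_diffP.
  exact: ex_derive.
transitivity (\int[@lebesgue_measure R]_(t in `[(- L)%R, L]) (F' t)%:E)%E.
  rewrite [RHS]integral_mkcond; apply: eq_integral => t _.
  by rewrite patchE; case: ifPn => // /negP; rewrite inE => /F'0 ->.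
rewrite (@continuous_FTC2 _ _ F).
- rewrite !F0 ?subee//= in_itv /=; first by rewrite ltxx.
  by rewrite ltxx andbF.
- by rewrite gtrN.
- exact: continuous_subspaceT.
- split.
  + by move=> t _; exact: ex_derive.
  + by apply: cvg_at_right_filter; exact: cF.
  + by apply: cvg_at_left_filter; exact: cF.
- by move=> t _; rewrite derive1E; exact: derive_val.
Qed.

(** Integrating first along the lines parallel to the axis of derivation
    gives zero on each of them. *)
Lemma integral_partial1_eq0 K f f1 f2 : C1_on setT f f1 f2 -> compact K ->
  (forall x, ~ K x -> f x = 0) -> (\int[@area R]_x (f1 x)%:E = 0)%E.
Proof.
move=> C cK f0; have [L L0 KL] := compact_sub_obox cK.
have d1 x : is_derive x (e1 R) f (f1 x) by have [] := C x I.
have cf1 : continuous f1 by move=> x; have [] := C x I.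
have f10 x : ~ K x -> f1 x = 0 by exact: derive_off_support f0 (d1 x).
rewrite -integral21_prod_meas1; last exact: (compact_support_integrable cf1 cK).
apply: integral0_eq => y _.
apply: (@integral_derive_line (fun t => f (t, y)) _ L) => //.
- by move=> t; have /is_derive_slice1 /= := d1 (t, y); apply.
- move=> t; apply: (@continuous_comp _ _ _ (fun t => (t, y)) f1); last exact: cf1.
  exact: pair_continuous1.
- by move=> t tL; apply: f0 => /KL[].
- by move=> t tL; apply: f10 => /KL/sub_obox_cbox[].
Qed.

Lemma integral_partial2_eq0 K f f1 f2 : C1_on setT f f1 f2 -> compact K ->
  (forall x, ~ K x -> f x = 0) -> (\int[@area R]_x (f2 x)%:E = 0)%E.
Proof.
move=> C cK f0; have [L L0 KL] := compact_sub_obox cK.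
have d2 x : is_derive x (e2 R) f (f2 x) by have [] := C x I.
have cf2 : continuous f2 by move=> x; have [] := C x I.
have f20 x : ~ K x -> f2 x = 0 by exact: derive_off_support f0 (d2 x).
rewrite -integral12_prod_meas1; last exact: (compact_support_integrable cf2 cK).
apply: integral0_eq => y _.
apply: (@integral_derive_line (fun t => f (y, t)) _ L) => //.
- by move=> t; have /is_derive_slice2 /= := d2 (y, t); apply.
- move=> t; apply: (@continuous_comp _ _ _ (fun t => (y, t)) f2); last exact: cf2.
  exact: pair_continuous2.
- by move=> t tL; apply: f0 => /KL[].
- by move=> t tL; apply: f20 => /KL/sub_obox_cbox[].
Qed.

(** A product with a factor of compact support inside [O] extends by zero. *)
Lemma C1_extend O K f f1 f2 : open O -> compact K -> K `<=` O ->
  C1_on O f f1 f2 -> (forall x, ~ K x -> f x = 0) ->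
  (forall x, ~ K x -> f1 x = 0) -> (forall x, ~ K x -> f2 x = 0) ->
  C1_on setT f f1 f2.
Proof.
move=> oO cK KO C f0 f10 f20 x _; have [Ox|Ox] := pselect (O x); first exact: C.
have oK : open (~` K).
  by apply: closed_openC; apply: compact_closed => //; exact: plane_hausdorff.
suff : C1_on (~` K) f f1 f2 by apply => Kx; apply: Ox; exact: KO.
by apply: C1_ext (@C1_cst R (~` K) 0) => // y Ky; rewrite ?f0 ?f10 ?f20.
Qed.

End PlaneIntegration.

(** * Flat functions and smoothness by coinduction *)

Section Bumps.
Variable R : realType.

Lemma smooth_derivable (f : R -> R) (t : R) : smooth f -> derivable f t 1.
Proof. by move=> /(_ 0%N t). Qed.

Lemma smooth_is_derive (f : R -> R) (t : R) : smooth f ->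
  is_derive t 1 f (derive1 f t).
Proof. by move=> sf; rewrite derive1E; exact/derivableP/smooth_derivable. Qed.

Lemma smooth_derive1 (f : R -> R) : smooth f -> smooth (derive1 f).
Proof. by move=> sf n t; rewrite -derive1Sn; exact: sf. Qed.

Lemma smooth_derive1n (f : R -> R) n : smooth f -> smooth (derive1n n f).
Proof.
by elim: n f => [//|n IH] f sf; rewrite derive1Sn; exact/IH/smooth_derive1.
Qed.

Lemma smooth_continuous (f : R -> R) : smooth f -> continuous f.
Proof.
move=> sf t; apply/differentiable_continuous/derivable1_diffP.
exact: smooth_derivable.
Qed.

(** Smoothness by coinduction: a class of differentiable functions that is
    stable under derivation consists of smooth functions.  This spares
    formulas for the derivatives of higher order. *)
Lemma smooth_coind (S : (R -> R) -> Prop) :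
  (forall f, S f -> exists2 g, S g & forall t : R, is_derive t 1 f (g t)) ->
  forall f, S f -> smooth f.
Proof.
move=> HS f Sf n t.
have Sn : S (derive1n n f).
  elim: n => [//|n /HS[g Sg dg]]; rewrite derive1nS.
  rewrite (_ : derive1 _ = g)//; apply/funext => s.
  by rewrite derive1E; exact: derive_val.
by have [g _ dg] := HS _ Sn; exact: ex_derive.
Qed.

(** The class generated by the Leibniz rule from a single product. *)
Inductive sum_of_products : (R -> R) -> Prop :=
| Sum_product f g : smooth f -> smooth g -> sum_of_products (fun t => f t * g t)
| Sum_add f g : sum_of_products f -> sum_of_products g ->
    sum_of_products (fun t => f t + g t).

Lemma smoothM (f g : R -> R) : smooth f -> smooth g -> smooth (fun t => f t * g t).
Proof.
move=> sf sg; apply: (smooth_coind _ (Sum_product sf sg)) => h.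
elim=> {sf sg f g h}[f g sf sg|f g _ [f' Sf df] _ [g' Sg dg]].
  exists (fun t => f t * derive1 g t + derive1 f t * g t).
    by apply: Sum_add; apply: Sum_product => //; exact: smooth_derive1.
  move=> t; rewrite [derive1 f t * _]mulrC; apply: is_deriveM; exact: smooth_is_derive.
by exists (fun t => f' t + g' t) => [|t]; [exact: Sum_add|exact: is_deriveD].
Qed.

(** The class used for the coinduction contains the constant factor that each
    derivation produces. *)
Lemma smooth_affine (f : R -> R) (k c : R) : smooth f ->
  smooth (fun t => f (k * t + c)).
Proof.
move=> sf; pose S h := exists m g, smooth g /\ h = (fun t => m * g (k * t + c)).
apply: (smooth_coind (S := S)); last first.
  by exists 1, f; split => //; apply/funext => t; rewrite mul1r.
move=> _ [m [g [sg ->]]]; exists (fun t => m * k * derive1 g (k * t + c)).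
  by exists (m * k), (derive1 g); split => //; exact: smooth_derive1.
move=> t; rewrite (_ : m * k * _ = m *: (derive1 g (k * t + c) * (k * 1 + 0))).
  apply: is_deriveZ; apply: (@is_derive1_comp _ g (fun t => k * t + c)).
  exact: smooth_is_derive.
by rewrite /GRing.scale /=; ring.
Qed.

(** For a polynomial [P], the function equal to P(1/y) exp(-1/y) on the right
    of zero and to zero on the left. The factor [P] makes the class stable
    under derivation; with [P] equal to one it is the classical smooth
    function that is not analytic. *)
Definition flat (P : {poly R}) (y : R) : R :=
  if 0 < y then P.[y^-1] * expR (- y^-1) else 0.

(** Induction on the polynomial needs a bound for all products with powers of
    the variable, since the Horner scheme multiplies by the variable. *)
Lemma poly_le_expR (P : {poly R}) :
  exists2 C : R, 0 <= C & forall z : R, 0 < z -> `|P.[z]| <= C * expR z.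
Proof.
suff /(_ 0%N)[C C0 HC] : forall k, exists2 C : R, 0 <= C &
    forall z, 0 < z -> `|P.[z]| * z ^+ k <= C * expR z.
  by exists C => // z /HC; rewrite expr0 mulr1.
elim/poly_ind: P => [|P c IH] k.
  by exists 0 => // z _; rewrite horner0 normr0 !mul0r.
have [C C0 HC] := IH k.+1.
exists (C + `|c| * (k`!%:R + 1)).
  by rewrite addr_ge0// mulr_ge0// addr_ge0.
move=> z z0; rewrite hornerMXaddC.
have zk : z ^+ k <= (k`!%:R + 1) * expR z.
  case: k {IH HC} => [|k].
    have := expR_ge1Dx z; rewrite expr0 fact0 => h; lra.
  have := expR_ge1Dxn k (ltW z0); set F := k.+1`!%:R => h.
  have F0 : 0 < F :> R by rewrite ltr0n fact_gt0.
  rewrite mulrDl mul1r ler_wpDr ?expR_ge0// -ler_pdivrMl// mulrC.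
  by apply: le_trans h; rewrite lerDr.
rewrite mulrDl; apply: le_trans (_ : (`|P.[z]| * z + `|c|) * z ^+ k <= _).
  by rewrite ler_wpM2r ?exprn_ge0 ?(ltW z0)// (le_trans (ler_normD _ _))//
      normrM (gtr0_norm z0).
rewrite mulrDl -mulrA -exprS lerD ?HC//.
by rewrite -mulrA ler_wpM2l.
Qed.

(** Exponential decay in 1/y beats P(1/y)/y^2. The quadratic bound is what
    makes the derivative at zero exist and vanish. *)
Lemma flat_le_sqr (P : {poly R}) :
  exists2 C : R, 0 <= C & forall y : R, `|flat P y| <= C * y ^+ 2.
Proof.
have [C C0 HC] := poly_le_expR (P * 'X^2); exists C => // y.
rewrite /flat; case: ifPn => [y0|_]; last by rewrite normr0 mulr_ge0 ?sqr_ge0.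
have y1 : 0 < y^-1 by rewrite invr_gt0.
have := HC _ y1; rewrite hornerM hornerXn => h.
have e0 : 0 < y ^+ 2 / expR y^-1 by rewrite divr_gt0 ?expR_gt0 ?exprn_gt0.
have -> : P.[y^-1] * expR (- y^-1) =
    P.[y^-1] * y^-1 ^+ 2 * (y ^+ 2 / expR y^-1).
  by rewrite expRN; field; rewrite ?gt_eqF ?expR_gt0 //.
rewrite normrM (gtr0_norm e0) (le_trans (ler_wpM2r (ltW e0) h))//.
by rewrite mulrA mulrAC mulfK// gt_eqF// expR_gt0.
Qed.

Lemma is_derive_sqr_bound (f : R -> R) (C : R) :
  (forall y, `|f y| <= C * y ^+ 2) -> is_derive (0 : R) 1 f 0.
Proof.
move=> Hf; have f0 : f 0 = 0.
  by apply/eqP; rewrite -normr_le0 (le_trans (Hf 0))// expr0n mulr0.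
suff L : (fun h : R => h^-1 *: ((f \o shift 0) (h *: 1) - f 0)) @ 0^' --> (0 : R).
  split; first by apply/cvg_ex; exists 0.
  exact: cvg_lim.
have C0 : (fun h : R => C * `|h|) @ 0^' --> (0 : R).
  rewrite -[X in _ --> X](mulr0 C); apply: cvgM; first exact: cvg_cst.
  rewrite -[X in _ --> X](@normr0 _ R); apply: cvg_norm.
  exact: cvg_within.
apply/norm_cvg0P; apply: squeeze_cvgr (cvg_cst 0) C0.
near=> h; rewrite normr_ge0 /= f0 subr0 addr0 /GRing.scale /= mulr1 normrM normfV.
have h0 : h != 0 by near: h; exact: nbhs_dnbhs_neq.
rewrite ler_pdivrMl ?normr_gt0// (le_trans (Hf h))//.
by rewrite -(@real_normK _ h) ?num_real// expr2 mulrCA.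
Unshelve. all: by end_near. Qed.

Lemma is_derive_flat (P : {poly R}) (y : R) :
  is_derive y 1 (flat P) (flat ('X^2 * (P - P^`())) y).
Proof.
have [y0|y0|->] := ltgtP y 0.
- rewrite {2}/flat ltNge (ltW y0) /=.
  apply: near_eq_is_derive (is_derive_cst (0 : R) y 1).
  near=> z; rewrite /flat ltNge ltW//.
  by near: z; exact: lt_nbhsl.
- have : is_derive y 1 (fun y => P.[y^-1] * expR (- y^-1)) (flat ('X^2 * (P - P^`())) y).
    rewrite /flat y0.
    have dinv : is_derive y 1 (fun t : R => t^-1) (- y ^- 2).
      apply: is_derive_eq; first by apply: is_deriveV; rewrite gt_eqF.
      by rewrite /GRing.scale /= mulr1.
    have dP : is_derive y 1 (fun t => P.[t^-1]) (P^`().[y^-1] * - y ^- 2).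
      apply: (@is_derive1_comp _ (horner P) (fun t : R => t^-1)).
    have dE : is_derive y 1 (fun t => expR (- t^-1)) (expR (- y^-1) * y ^- 2).
      apply: (@is_derive1_comp _ expR (fun t : R => - t^-1)).
      by apply: is_derive_eq (is_deriveN dinv) _; rewrite opprK.
    apply: is_derive_eq (is_deriveM dP dE) _.
    rewrite /GRing.scale /= hornerM hornerXn hornerD hornerN.
    by rewrite -exprVn; ring.
  apply: near_eq_is_derive; near=> z; rewrite /flat ifT//.
  by near: z; exact: lt_nbhsr.
- rewrite {2}/flat ltxx; have [C _ HC] := flat_le_sqr P.
  exact: is_derive_sqr_bound HC.
Unshelve. all: by end_near. Qed.

Lemma smooth_flat (P : {poly R}) : smooth (flat P).
Proof.
apply: (smooth_coind (S := [set f | exists P, f = flat P])); last by exists P.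
move=> _ [{}P ->]; exists (flat ('X^2 * (P - P^`()))); first by eexists.
exact: is_derive_flat.
Qed.

End Bumps.

(** * Smooth approximations of the indicators of boxes *)

Section Fundamental.
Variable R : realType.

(** Rescaling [flat 1] by [n] turns both flanks into smooth approximations of
    step functions, so that the product tends to the indicator of the open
    interval and vanishes outside it. *)
Definition plateau (n : nat) (a b t : R) : R :=
  flat 1 (n%:R * t + - (n%:R * a)) * flat 1 (- n%:R * t + n%:R * b).

Lemma smooth_plateau n a b : smooth (plateau n a b).
Proof. by apply: smoothM; apply: smooth_affine; exact: smooth_flat. Qed.

Lemma flat1_itv (y : R) : 0 <= flat 1 y <= 1.
Proof.
rewrite /flat; case: ifPn => y0; rewrite ?lexx ?ler01// hornerC mul1r.
rewrite expR_ge0 /= -expR0 ler_expR oppr_le0 invr_ge0 ltW//.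
Qed.

Lemma plateau_itv n a b t : 0 <= plateau n a b t <= 1.
Proof.
have /andP[h1 h2] := flat1_itv (n%:R * t + - (n%:R * a)).
have /andP[h3 h4] := flat1_itv (- n%:R * t + n%:R * b).
by rewrite /plateau mulr_ge0//= mulr_ile1.
Qed.

Lemma plateau_out n a b t : ~ `]a, b[%classic t -> plateau n a b t = 0.
Proof.
rewrite /= in_itv /= => /negP; rewrite negb_and -!leNgt => /orP[h|h].
- rewrite /plateau {1}/flat ifF ?mul0r//; apply/negbTE; rewrite -leNgt.
  by rewrite -mulrBr mulr_ge0_le0// subr_le0.
- rewrite /plateau {2}/flat ifF ?mulr0//; apply/negbTE; rewrite -leNgt.
  by rewrite mulNr addrC -mulrBr mulr_ge0_le0// subr_le0.
Qed.

Lemma flat1_cvg1 (y : R) : 0 < y -> (fun n : nat => flat 1 (n%:R * y)) @ \oo --> (1 : R).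
Proof.
move=> y0.
have : (fun n : nat => expR (- (y^-1 * n.+1%:R^-1))) @ \oo --> (1 : R).
  rewrite -[X in _ --> X]expR0 -[X in expR X]oppr0 -[X in - X](mulr0 y^-1).
  apply: (@continuous_cvg _ _ _ _ _ _ expR); first exact: continuous_expR.
  by apply: cvgN; apply: cvgM; [exact: cvg_cst|exact: cvg_harmonic].
move=> H; rewrite -cvg_shiftS; apply: cvg_trans H; apply: near_eq_cvg.
apply: nearW => n; rewrite /= /flat mulr_gt0 ?ltr0n//= hornerC mul1r.
by rewrite mulrC -invfM.
Qed.

Lemma plateau_cvg1 a b t : `]a, b[%classic t -> (fun n => plateau n a b t) @ \oo --> (1 : R).
Proof.
rewrite /= in_itv /= => /andP[ta tb].
have E n : plateau n a b t = flat 1 (n%:R * (t - a)) * flat 1 (n%:R * (b - t)).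
  by rewrite /plateau; congr (flat 1 _ * flat 1 _); ring.
have h1 : 0 < t - a by rewrite subr_gt0.
have h2 : 0 < b - t by rewrite subr_gt0.
have H : (fun n : nat => flat 1 (n%:R * (t - a)) * flat 1 (n%:R * (b - t))) @ \oo
    --> (1 * 1 : R) by apply: cvgM; exact: flat1_cvg1.
rewrite mulr1 in H.
by apply: cvg_trans H; apply: near_eq_cvg; apply: nearW => n; rewrite E.
Qed.

Lemma ord2P (j : 'I_2) : j = ord0 \/ j = ord_max.
Proof. by case: j => [[|[|//]] i]; [left|right]; apply: val_inj. Qed.

Definition tensor (b c : R -> R) (x : R * R) : R := b x.1 * c x.2.

Lemma is_derive_tensor1 (b c : R -> R) x : smooth b ->
  is_derive x (e1 R) (tensor b c) (tensor (derive1 b) c x).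
Proof.
move=> sb; apply/is_derive_slice1; rewrite /tensor /=.
rewrite [X in is_derive _ _ X](_ : _ = c x.2 *: b).
  by rewrite mulrC; apply: is_deriveZ; exact: smooth_is_derive.
by apply/funext => t; rewrite mulrC.
Qed.

Lemma is_derive_tensor2 (b c : R -> R) x : smooth c ->
  is_derive x (e2 R) (tensor b c) (tensor b (derive1 c) x).
Proof.
move=> sc; apply/is_derive_slice2; rewrite /tensor /=.
by apply: (@is_deriveZ _ _ _ c (b x.1)); exact: smooth_is_derive.
Qed.

(** Every iterated partial derivative of a tensor product is again a tensor
    product of smooth functions. *)
Lemma smooth2_tensor (b c : R -> R) : smooth b -> smooth c -> smooth2 (tensor b c).
Proof.
move=> sb sc s /=.
have [b' [c' [sb' [sc' ->]]]] : exists b' c', smooth b' /\ smooth c' /\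
    foldr (@partial R) (tensor b c) s = tensor b' c'.
  elim: s => [|j s [b' [c' [sb' [sc' /= ->]]]]]; first by exists b, c.
  have [->|->] := ord2P j.
  - exists (derive1 b'), c'; split; first exact: smooth_derive1.
    split => //; apply/funext => x.
    have h := is_derive_tensor1 c' x sb'; exact: derive_val.
  - exists b', (derive1 c'); split => //; split; first exact: smooth_derive1.
    apply/funext => x.
    have h := is_derive_tensor2 b' x sc'; exact: derive_val.
split=> [x|j x].
  apply: continuousM.
    apply: (@continuous_comp _ _ _ fst b'); first exact: cvg_fst.
    exact: smooth_continuous.
  apply: (@continuous_comp _ _ _ snd c'); first exact: cvg_snd.
  exact: smooth_continuous.
have [->|->] := ord2P j.
  have h := is_derive_tensor1 c' x sb'; exact: ex_derive.
have h := is_derive_tensor2 b' x sc'; exact: ex_derive.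
Qed.

Definition oboxes : set (set (R * R)) :=
  [set A | exists a b c d, A = obox a b c d].

Lemma oboxes_setI : setI_closed oboxes.
Proof.
move=> _ _ [a [b [c [d ->]]]] [a' [b' [c' [d' ->]]]].
exists (Num.max a a'), (Num.min b b'), (Num.max c c'), (Num.min d d').
apply/seteqP; split => x /=; rewrite /obox /= !in_itv /= !gt_max !lt_min.
  by move=> [[/andP[-> ->] /andP[-> ->]] [/andP[-> ->] /andP[-> ->]]].
by move=> [/andP[/andP[-> ->] /andP[-> ->]] /andP[/andP[-> ->] /andP[-> ->]]].
Qed.

(** Boxes already make both projections measurable, since strips are
    countable unions of boxes. *)
Lemma measurable_oboxes :
  @measurable _ (measurableTypeR R * measurableTypeR R)%type = <<s oboxes >>.
Proof.
apply/seteqP; split; last first.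
  apply: smallest_sub; first exact: sigma_algebra_measurable.
  by move=> _ [a [b [c [d ->]]]]; exact: measurable_obox.
have mG a b c d : oboxes.-sigma.-measurable (obox a b c d).
  by apply: sub_sigma_algebra; exists a, b, c, d.
have m1 : measurable_fun setT (fst : g_sigma_algebraType oboxes -> measurableTypeR R).
  apply: (@measurability _ _ _ _ _ _ (@RGenOpens.G R)).
    exact: RGenOpens.measurableE.
  move=> _ [_ [a [b ->]] <-].
  rewrite setTI (_ : _ @^-1` _ = \bigcup_n obox a b (- n%:R) n%:R).
    by apply: bigcup_measurable => n _; exact: mG.
  by rewrite -setX_bigcupr bigcup_itvT; apply/seteqP; split => x //= [].
have m2 : measurable_fun setT (snd : g_sigma_algebraType oboxes -> measurableTypeR R).
  apply: (@measurability _ _ _ _ _ _ (@RGenOpens.G R)).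
    exact: RGenOpens.measurableE.
  move=> _ [_ [a [b ->]] <-].
  rewrite setTI (_ : _ @^-1` _ = \bigcup_n obox (- n%:R) n%:R a b).
    by apply: bigcup_measurable => n _; exact: mG.
  by rewrite -setX_bigcupl bigcup_itvT; apply/seteqP; split => x //= [].
rewrite measurable_prod_measurableType; apply: smallest_sub.
  exact: smallest_sigma_algebra.
move=> _ [A mA [B mB <-]].
have -> : A `*` B = (setT `&` fst @^-1` A) `&` (setT `&` snd @^-1` B).
  by rewrite !setTI; apply/seteqP; split.
by apply: (@measurableI _ (g_sigma_algebraType oboxes)); [exact: m1|exact: m2].
Qed.

End Fundamental.

(** * The fundamental lemma of the calculus of variations on a box *)

Section WeakIsClassical.
Variable R : realType.
Implicit Types (O Q : set (R * R)) (f g : R * R -> R).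

Lemma integral_support A B (f : R * R -> \bar R) : A `<=` B ->
  (forall x, B x -> ~ A x -> f x = 0%E) ->
  (\int[@area R]_(x in B) f x = \int[@area R]_(x in A) f x)%E.
Proof.
move=> AB f0; rewrite integral_mkcond [RHS]integral_mkcond.
congr (integral _ _ _); apply/funext => x; rewrite !patchE.
case: ifPn => [/set_mem Bx|/negP Bx]; case: ifPn => [/set_mem Ax|/negP Ax] //.
- by apply: f0 => // /mem_set.
- by case: Bx; apply/mem_set/AB.
Qed.

Lemma test_function_tensor_plateau O n (a b c d : R) : cbox a b c d `<=` O ->
  test_function O (tensor (plateau n a b) (plateau n c d)).
Proof.
move=> QO; split; first by apply: smooth2_tensor; exact: smooth_plateau.
exists (cbox a b c d); split => //; first exact: compact_cbox.
move=> x Qx; rewrite /tensor.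
have [h1|/(@plateau_out _ n) ->] := pselect (`]a, b[%classic x.1); last by rewrite mul0r.
have [h2|/(@plateau_out _ n) ->] := pselect (`]c, d[%classic x.2); last by rewrite mulr0.
by case: Qx; exact: sub_obox_cbox.
Qed.

Section OneBox.
Variables (O : set (R * R)) (a b c d : R) (g : R * R -> R).
Let Q := obox a b c d.
Hypothesis QO : cbox a b c d `<=` O.
Hypothesis ig : (@area R).-integrable Q (EFin \o g).
Hypothesis g_orth : forall f, test_function O f -> (forall x, ~ Q x -> f x = 0) ->
  (\int[@area R]_(x in Q) (g x * f x)%:E = 0)%E.

Let mQ : measurable Q. Proof. exact: measurable_obox. Qed.

Let integral_subbox a' b' c' d' : cbox a' b' c' d' `<=` cbox a b c d ->
  obox a' b' c' d' `<=` Q ->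
  (\int[@area R]_(x in obox a' b' c' d') (g x)%:E = 0)%E.
Proof.
move=> cQ oQ; set Q' := obox a' b' c' d'.
have mQ' : measurable Q' by exact: measurable_obox.
pose f n := tensor (plateau n a' b') (plateau n c' d').
have ig' : (@area R).-integrable Q' (EFin \o g) by exact: integrableS ig.
have f_out n x : ~ Q' x -> f n x = 0.
  rewrite /f /tensor => Qx.
  have [h1|/(@plateau_out _ n) ->] := pselect (`]a', b'[%classic x.1); last by rewrite mul0r.
  have [h2|/(@plateau_out _ n) ->] := pselect (`]c', d'[%classic x.2); last by rewrite mulr0.
  by case: Qx.
have f_itv n x : 0 <= f n x <= 1.
  have /andP[h1 h2] := plateau_itv n a' b' x.1.
  have /andP[h3 h4] := plateau_itv n c' d' x.2.
  by rewrite /f /tensor mulr_ge0//= mulr_ile1.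
have f0 n : (\int[@area R]_(x in Q') (g x * f n x)%:E = 0)%E.
  rewrite -(@integral_support _ Q)//; last first.
    by move=> x _ /(f_out n) ->; rewrite mulr0.
  apply: g_orth; last by move=> x Qx; apply: f_out => /oQ.
  by apply: test_function_tensor_plateau; exact: subset_trans QO.
have mf n : measurable_fun Q' (EFin \o (fun x => g x * f n x)).
  apply/measurable_EFinP; apply: measurable_funM.
    by apply/measurable_EFinP; exact: measurable_int ig'.
  apply: (measurable_funS measurableT) => //.
  apply: measurable_fun_continuous_on; first exact: openT.
  move=> x _; have [] := smooth2_tensor (@smooth_plateau R n a' b')
    (@smooth_plateau R n c' d') [::].
  by move=> h _; exact: h.
have [] := @dominated_convergence _ _ _ (@area R) Q' mQ'
  (fun n => EFin \o (fun x => g x * f n x)) (EFin \o g) (EFin \o (fun x => `|g x|)) mf.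
- exact: measurable_int ig'.
- apply: aeW => x Q'x; apply: cvg_EFin; first exact: nearW.
  rewrite -[X in _ --> X]mulr1; apply: cvgM; first exact: cvg_cst.
  by rewrite -[X in _ --> X]mulr1; apply: cvgM; apply: plateau_cvg1; case: Q'x.
- exact: integrable_abse ig'.
- apply: aeW => x n Q'x; rewrite /= lee_fin normrM ler_piMr//.
  by have /andP[h1 h2] := f_itv n x; rewrite ger0_norm.
move=> _ _; under eq_fun do rewrite f0.
by move=> /cvg_lim; rewrite lim_cst// => ->.
Qed.

(** Letting the plateau functions tend to indicators, [g] has zero integral
    over every subbox. The sets on which the integral of [g] vanishes form a
    Dynkin class and the boxes are stable under intersection, so [g] has zero
    integral over every measurable subset of the box. *)
Lemma orthogonal_box_ae0 : {ae @area R, forall x, Q x -> g x = 0}.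
Proof.
have eq0 S : measurable S -> (\int[@area R]_(x in Q `&` S) (g x)%:E = 0)%E.
  move=> mS; have : <<s @oboxes R >> S by rewrite -measurable_oboxes.
  apply: (@dynkin_induction _ (measurableTypeR R * measurableTypeR R)%type (@oboxes R)
    [set S | (\int[@area R]_(x in Q `&` S) (g x)%:E = 0)%E]).
  - exact: measurable_oboxes.
  - exact: oboxes_setI.
  - by rewrite /= setIT; exact: integral_subbox.
  - move=> _ [a' [b' [c' [d' ->]]]].
    rewrite /= [X in integral _ X _](_ : _ =
        obox (Num.max a a') (Num.min b b') (Num.max c c') (Num.min d d')); last first.
      apply/seteqP; split => x /=; rewrite /Q /obox /= !in_itv /= !gt_max !lt_min.
        by move=> [[/andP[-> ->] /andP[-> ->]] [/andP[-> ->] /andP[-> ->]]].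
      by move=> [/andP[/andP[-> ->] /andP[-> ->]] /andP[/andP[-> ->] /andP[-> ->]]].
    apply: integral_subbox => x; rewrite /Q /obox /cbox /= !in_itv /=.
      by rewrite !ge_max !le_min =>
        -[/andP[/andP[-> _] /andP[-> _]] /andP[/andP[-> _] /andP[-> _]]].
    by rewrite !gt_max !lt_min =>
      -[/andP[/andP[-> _] /andP[-> _]] /andP[/andP[-> _] /andP[-> _]]].
  - move=> T mT /= T0.
    have := @integral_setU _ _ _ (@area R) (Q `&` T) (Q `&` ~` T) (EFin \o g).
    rewrite -setIUr setUv setIT /= T0 add0e integral_subbox// => <- //.
    + exact: measurableI.
    + by apply: measurableI => //; exact: measurableC.
    + exact: measurable_int ig.
    + by apply/disj_setPS => x [[_ ?] []].
  - move=> F mF tF F0 /=; rewrite setI_bigcupr integral_bigcup//=.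
    + by apply: eseries0 => n _ _; exact: F0.
    + exact: trivIset_setIl.
    + by move=> n; exact: measurableI.
    + rewrite -setI_bigcupr; apply: integrableS ig => //.
      by apply: measurableI => //; exact: bigcupT_measurable.
have H := @integral_ae_eq _ _ _ (@area R) Q mQ (cst 0%E) (EFin \o g) ig.
have : ae_eq (@area R) Q (EFin \o g) (cst 0%E).
  apply: H => // E EQ mE.
  by rewrite integral0 -[X in integral _ X _](setIidr EQ) eq0.
by apply: filterS => x Hx Qx; have [] := Hx Qx.
Qed.

End OneBox.

End WeakIsClassical.

(** * Weak derivatives of continuously differentiable functions *)

Section WeakGradient.
Variable R : realType.
Implicit Types (O D K : set (R * R)) (f g h u v w : R * R -> R).

Lemma ae_areaS (P Q : set (R * R)) : (forall x, P x -> Q x) ->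
  {ae @area R, forall x, P x} -> {ae @area R, forall x, Q x}.
Proof. by move=> PQ; apply: (@filterS _ _ (ae_filter_ringOfSetsType (@area R))). Qed.

Lemma ae_areaI (P Q : set (R * R)) : {ae @area R, forall x, P x} ->
  {ae @area R, forall x, Q x} -> {ae @area R, forall x, P x /\ Q x}.
Proof. exact: (@filterI _ _ (ae_filter_ringOfSetsType (@area R))). Qed.

Lemma bounded_integrableM D h f (B : R) : measurable D ->
  measurable_fun D h -> (forall x, D x -> `|h x| <= B) ->
  (@area R).-integrable D (EFin \o f) ->
  (@area R).-integrable D (EFin \o (fun x => h x * f x)).
Proof.
move=> mD mh hB fi.
have bh : [bounded h x | x in D].
  exists B; split; first exact: num_real.
  by move=> y By x Dx; exact: le_trans (hB x Dx) (ltW By).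
rewrite (_ : EFin \o _ = (EFin \o h) \* (EFin \o f))%E; first exact: integrableMr.
by apply/funext => x; rewrite /= EFinM.
Qed.

Lemma continuous_cbox_integrable f (a b c d : R) :
  (forall x, cbox a b c d x -> {for x, continuous f}) ->
  measurable_fun (cbox a b c d) f ->
  (@area R).-integrable (cbox a b c d) (EFin \o f).
Proof.
move=> cf mf; have mC := @measurable_cbox R a b c d.
apply: measurable_bounded_integrable => //; first exact: area_cbox_lty.
have [B _ HB] := compact_fun_bounded (@compact_cbox R a b c d) cf.
exists B; split; first exact: num_real.
by move=> y By x Dx; exact: le_trans (HB x Dx) (ltW By).
Qed.

Lemma smooth2_C1 f : smooth2 f ->
  C1_on setT f (partial ord0 f) (partial ord_max f).
Proof.
move=> sf x _; have [cf df] := sf [::].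
have [c1 _] := sf [:: ord0]; have [c2 _] := sf [:: ord_max].
by split; [exact: cf|exact: c1|exact: c2| |]; apply: derivableP; exact: df.
Qed.

Lemma C1_for_j O v (dv : 'I_2 -> R * R -> R) :
  C1_on O v (dv ord0) (dv ord_max) ->
  forall (j : 'I_2) x, O x -> [/\ {for x, continuous v}, {for x, continuous (dv j)} &
    is_derive x (axis R j) v (dv j x)].
Proof.
by move=> C j x /C[cv c1 c2 d1 d2]; have [->|->] := ord2P j.
Qed.

Lemma integral_partial_eq0 K f (df : 'I_2 -> R * R -> R) (j : 'I_2) :
  C1_on setT f (df ord0) (df ord_max) -> compact K ->
  (forall x, ~ K x -> f x = 0) -> (\int[@area R]_x (df j x)%:E = 0)%E.
Proof.
have [->|->] := ord2P j; first exact: integral_partial1_eq0.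
exact: integral_partial2_eq0.
Qed.

(** On each box of a countable cover of [O], integration by parts shows that
    the difference between the weak and the classical derivative is
    orthogonal to all test functions supported in the box. *)
Lemma weak_derivative_classical O D v u w (dv : 'I_2 -> R * R -> R) (j : 'I_2) :
  open O -> O `<=` D -> measurable D ->
  C1_on O v (dv ord0) (dv ord_max) ->
  {ae @area R, forall x, O x -> u x = v x} ->
  measurable_fun D u ->
  (@area R).-integrable D (EFin \o w) ->
  (forall f, test_function D f ->
    (\int[@area R]_(x in D) (u x * partial j f x)%:E =
     - \int[@area R]_(x in D) (w x * f x)%:E)%E) ->
  {ae @area R, forall x, O x -> w x = dv j x}.
Proof.
move=> oO OD mD Cv uv mu iw weak.
have [B [BO OE]] := open_bigcup_box oO.
suff boxes n : {ae @area R, forall x,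
    obox (B n).1.1.1 (B n).1.1.2 (B n).1.2 (B n).2 x -> w x - dv j x = 0}.
  have : (@area R).-negligible (\bigcup_n (~` [set x |
      obox (B n).1.1.1 (B n).1.1.2 (B n).1.2 (B n).2 x -> w x - dv j x = 0])).
    by apply: negligible_bigcup => n; exact: boxes.
  apply: negligibleS => x /= Hx; rewrite OE in Hx.
  apply: contrapT => Nx; apply: Hx => -[n _ nx].
  apply/eqP; rewrite -subr_eq0; apply/eqP; apply: contrapT => wx.
  by apply: Nx; exists n => //= H; exact/wx/H.
move: (B n) (BO n) => [[[a b] c] d] /= {B BO OE} CO.
set C := cbox a b c d in CO *; set Q := obox a b c d.
have mC : measurable C by exact: measurable_cbox.
have mQ : measurable Q by exact: measurable_obox.
have QC : Q `<=` C by exact: sub_obox_cbox.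
have CD : C `<=` D by exact: subset_trans OD.
have mO : measurable O by exact: open_measurable2.
have cdv x : O x -> {for x, continuous (dv j)} by move=> /(@C1_for_j _ _ _ Cv j)[].
have cv x : O x -> {for x, continuous v} by move=> /(@C1_for_j _ _ _ Cv j)[].
have mdvC : measurable_fun C (dv j).
  by apply: (measurable_funS mO) => //; exact: measurable_fun_continuous_on.
have mvC : measurable_fun C v.
  by apply: (measurable_funS mO) => //; exact: measurable_fun_continuous_on.
have idv : (@area R).-integrable C (EFin \o dv j).
  by apply: continuous_cbox_integrable => // x /CO; exact: cdv.
have iv : (@area R).-integrable C (EFin \o v).
  by apply: continuous_cbox_integrable => // x /CO; exact: cv.
have iwC : (@area R).-integrable C (EFin \o w) by exact: integrableS iw.
apply: (@orthogonal_box_ae0 R O) => //.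
  apply: (@integrableS _ _ _ (@area R) C) => //.
  exact: (@integrableB _ _ _ (@area R) C mC (EFin \o w) (EFin \o dv j)).
move=> f tf f0; have [sf [K [cK KO fK]]] := tf.
pose pf (i : 'I_2) := partial i f.
have Cf : C1_on setT f (pf ord0) (pf ord_max) by exact: smooth2_C1.
have cf : continuous f by move=> x; have [] := @C1_for_j _ _ _ Cf j x I.
have cpf : continuous (pf j) by move=> x; have [] := @C1_for_j _ _ _ Cf j x I.
have f0C x : ~ C x -> f x = 0 by move=> Cx; apply: f0 => /QC.
have pf0C x : ~ C x -> pf j x = 0.
  move=> Cx; have [_ _ df] := @C1_for_j _ _ _ Cf j x I.
  exact: (derive_off_support (@compact_cbox R a b c d) f0C df).
have bM h : continuous h -> exists2 M : R, 0 <= M & forall x, C x -> `|h x| <= M.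
  by move=> ch; exact: (compact_fun_bounded (@compact_cbox R a b c d) (fun x _ => ch x)).
have mcont h : continuous h -> measurable_fun C h.
  move=> ch; apply: (measurable_funS measurableT) => //.
  by apply: measurable_fun_continuous_on => [|x _]; [exact: openT|exact: ch].
have [M _ fM] := bM f cf; have [M' _ pfM] := bM (pf j) cpf.
have ifw := bounded_integrableM mC (mcont _ cf) fM iwC.
have ifdv := bounded_integrableM mC (mcont _ cf) fM idv.
have ipfv := bounded_integrableM mC (mcont _ cpf) pfM iv.
have E1 : (\int[@area R]_(x in C) (pf j x * v x)%:E =
    - \int[@area R]_(x in C) (f x * w x)%:E)%E.
  have tfD : test_function D f.
    by split=> //; exists K; split=> //; exact: subset_trans OD.
  have := weak f tfD; rewrite (@integral_support _ C)//; last first.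
    by move=> x _ Cx; rewrite [partial _ _ _]pf0C// mulr0.
  rewrite [X in (- X)%E](@integral_support _ C)//; last first.
    by move=> x _ Cx; rewrite f0C// mulr0.
  under [X in (- X)%E]eq_integral do rewrite mulrC.
  move=> <-; apply: ae_eq_integral => //.
  - exact: measurable_int ipfv.
  - apply/measurable_EFinP; apply: measurable_funM; last exact: mcont.
    exact: measurable_funS mu.
  - by move: uv; apply: ae_areaS => x uvx /CO/uvx ->; rewrite mulrC.
have E2 : (\int[@area R]_(x in C) (f x * dv j x)%:E =
    - \int[@area R]_(x in C) (pf j x * v x)%:E)%E.
  have Cvf := C1_mul Cv (C1_sub (@subsetT _ O) Cf).
  have CvfT : C1_on setT (fun x => v x * f x)
    (fun x => dv ord0 x * f x + v x * pf ord0 x)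
    (fun x => dv ord_max x * f x + v x * pf ord_max x).
    apply: (C1_extend oO cK KO Cvf).
    + by move=> y Ky; rewrite fK// mulr0.
    + move=> y Ky; have [_ _ _ d1 _] := Cf y I.
      by rewrite fK// (derive_off_support cK fK d1 Ky) !mulr0 addr0.
    + move=> y Ky; have [_ _ _ _ d2] := Cf y I.
      by rewrite fK// (derive_off_support cK fK d2 Ky) !mulr0 addr0.
  have vf0 y : ~ K y -> v y * f y = 0 by move=> /fK ->; rewrite mulr0.
  have := @integral_partial_eq0 K _ (fun i x => dv i x * f x + v x * pf i x) j CvfT cK vf0.
  rewrite (@integral_support _ C setT _ (@subsetT _ C)); last first.
    by move=> y _ Cy; rewrite f0C// pf0C// !mulr0 addr0.
  under eq_integral do rewrite mulrC [v _ * _]mulrC EFinD.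
  rewrite integralD//.
  have := @integrable_fin_num _ _ _ (@area R) C mC _ ipfv.
  have := @integrable_fin_num _ _ _ (@area R) C mC _ ifdv.
  move=> /fineK <- /fineK <-; rewrite -EFinD -EFinN => -[] /eqP.
  by rewrite addr_eq0 => /eqP ->.
rewrite -(@integral_support _ Q C)//; last by move=> x _ Qx; rewrite f0// mulr0.
under eq_integral do rewrite mulrC mulrBr EFinB.
rewrite integralB// E2 E1 oppeK subee//.
exact: (@integrable_fin_num _ _ _ (@area R) C mC _ ifw).
Qed.

End WeakGradient.

(** * Radial cutoffs around the origin *)

Section Cutoff.
Variable R : realType.

(** The square of the positive part is continuously differentiable, which is
    all that a cutoff needs here, and its derivative is explicit. *)
Definition possq (y : R) : R := Num.max 0 y ^+ 2.
Definition dpossq (y : R) : R := 2 * Num.max 0 y.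

Lemma is_derive_possq (y : R) : is_derive y 1 possq (dpossq y).
Proof.
have [y0|y0|->] := ltgtP y 0.
- rewrite /dpossq max_l ?(ltW y0)// mulr0.
  apply: near_eq_is_derive (is_derive_cst (0 : R) y 1).
  near=> z; rewrite /possq max_l ?expr0n//.
  by apply: ltW; near: z; exact: lt_nbhsl.
- rewrite /dpossq max_r ?(ltW y0)//.
  have : is_derive y 1 (fun z : R => z ^+ 2) (2 * y).
    apply: is_derive_eq (is_deriveM (is_derive_id y (1 : R)) (is_derive_id y 1)) _.
    by rewrite /GRing.scale /= mulr1 mulr_natl.
  apply: near_eq_is_derive; near=> z; rewrite /possq max_r//.
  by apply: ltW; near: z; exact: lt_nbhsr.
- rewrite /dpossq maxxx mulr0; apply: (@is_derive_sqr_bound _ _ 1) => z.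
  rewrite mul1r /possq ger0_norm ?sqr_ge0//.
  by have [z0|z0] := leP 0 z; rewrite ?expr0n ?sqr_ge0.
Unshelve. all: by end_near. Qed.

Lemma continuous_dpossq : continuous dpossq.
Proof.
have -> : dpossq = (fun y => y + `|y|).
  apply/funext => y; rewrite /dpossq maxr_absE sub0r add0r normrN.
  by rewrite mulrC divfK// pnatr_eq0.
by move=> y; apply: continuousD; [exact: cvg_id|exact: norm_continuous].
Qed.

Lemma possq_ge0 y : 0 <= possq y. Proof. exact: sqr_ge0. Qed.

Definition normsq (x : R * R) : R := x.1 ^+ 2 + x.2 ^+ 2.

Definition pcoord (j : 'I_2) (x : R * R) : R := if j == ord0 then x.1 else x.2.

(** The nested squares produce a radial function that vanishes where
    [m ^+ 2 * normsq x] is small and is equal to one where it is at least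
    one. *)
Definition cutoff (m : R) (x : R * R) : R :=
  possq (1 - possq (4 * (1 - m ^+ 2 * normsq x))).

Definition dcutoff (m : R) (j : 'I_2) (x : R * R) : R :=
  dpossq (1 - possq (4 * (1 - m ^+ 2 * normsq x))) *
  (dpossq (4 * (1 - m ^+ 2 * normsq x)) * (8 * m ^+ 2 * pcoord j x)).

Lemma C1_normsq O : C1_on O normsq (fun x => 2 * pcoord ord0 x)
  (fun x => 2 * pcoord ord_max x).
Proof.
have C := C1_add (C1_mul (@C1_fst R setT) (@C1_fst R setT))
  (C1_mul (@C1_snd R setT) (@C1_snd R setT)).
apply: (C1_sub (@subsetT _ O)); apply: C1_ext C => [|x _|x _|x _].
- exact: openT.
- by rewrite /normsq !expr2.
- by rewrite /pcoord /=; ring.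
- by rewrite /pcoord /=; ring.
Qed.

Lemma C1_cutoff m : C1_on setT (cutoff m) (dcutoff m ord0) (dcutoff m ord_max).
Proof.
pose O : set (R * R) := setT.
have Cs : C1_on O (fun x => 4 * (1 - m ^+ 2 * normsq x))
    (fun x => - 8 * m ^+ 2 * pcoord ord0 x)
    (fun x => - 8 * m ^+ 2 * pcoord ord_max x).
  have C := C1_mul (@C1_cst R O 4) (C1_add (@C1_cst R O 1)
    (C1_opp (C1_mul (@C1_cst R O (m ^+ 2)) (@C1_normsq O)))).
  apply: C1_ext C => [|x _|x _|x _] //; first exact: openT.
  - by ring.
  - by ring.
have dq (t : R) : setT t -> is_derive t 1 possq (dpossq t) by move=> _; exact: is_derive_possq.
have cq (t : R) : setT t -> {for t, continuous dpossq} by move=> _; exact: continuous_dpossq.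
have C1 := @C1_comp R O setT possq dpossq _ _ _ dq cq (fun _ _ => I) Cs.
have C2 := @C1_comp R O setT possq dpossq _ _ _ dq cq (fun _ _ => I)
  (C1_add (@C1_cst R O 1) (C1_opp C1)).
apply: C1_ext C2 => [|x _|x _|x _] //; first exact: openT.
- by rewrite /dcutoff; ring.
- by rewrite /dcutoff; ring.
Qed.

Lemma cutoff_itv m x : 0 <= cutoff m x <= 1.
Proof.
rewrite possq_ge0 /= /cutoff; set t := possq (4 * _).
have t0 : 0 <= t by exact: possq_ge0.
rewrite /possq expr_le1 ?le_max ?lexx//.
by rewrite ge_max ler01 /= gerBl.
Qed.

Lemma cutoff_near0 m x : m ^+ 2 * normsq x <= 4^-1 -> cutoff m x = 0.
Proof.
move=> h; have h3 : 3 <= 4 * (1 - m ^+ 2 * normsq x) by lra.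
have h1 : 1 <= possq (4 * (1 - m ^+ 2 * normsq x)).
  rewrite /possq max_r; last by apply: le_trans h3.
  by rewrite exprn_ege1// (le_trans _ h3)// ler1n.
by rewrite /cutoff /possq max_l ?expr0n// subr_le0.
Qed.

Lemma possq_le0 y : y <= 0 -> possq y = 0.
Proof. by move=> y0; rewrite /possq max_l// expr0n. Qed.

Lemma cutoff_far m x : 1 <= m ^+ 2 * normsq x -> cutoff m x = 1.
Proof.
move=> h; rewrite /cutoff (@possq_le0 (4 * _)) ?subr0; last by lra.
by rewrite /possq max_r ?ler01// expr1n.
Qed.

Lemma dcutoff_far m j x : 1 <= m ^+ 2 * normsq x -> dcutoff m j x = 0.
Proof.
move=> h; rewrite /dcutoff /dpossq [in X in _ * (X * _)]max_l; last by lra.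
by rewrite mulr0 mul0r mulr0.
Qed.

(** The three factors are at most 2, 8 and [8 * m], because the derivative
    lives where [m ^+ 2 * normsq x < 1]. Only the linear growth in [m]
    matters: it is compensated by the area of the support, which is of order
    [m ^- 2]. *)
Lemma dcutoff_bound m j x : 0 <= m -> `|dcutoff m j x| <= 128 * m.
Proof.
move=> m0; have [h|h] := leP 1 (m ^+ 2 * normsq x).
  by rewrite dcutoff_far// normr0 mulr_ge0.
set s := m ^+ 2 * normsq x in h *.
have s0 : 0 <= s by rewrite mulr_ge0 ?sqr_ge0// addr_ge0 ?sqr_ge0.
have d1 : `|dpossq (1 - possq (4 * (1 - s)))| <= 2.
  have p0 := possq_ge0 (4 * (1 - s)).
  rewrite /dpossq normrM ger0_norm// ler_piMr// ger0_norm ?le_max ?lexx//.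
  by rewrite ge_max ler01 /=; lra.
have d2 : `|dpossq (4 * (1 - s))| <= 8.
  rewrite /dpossq max_r; last by lra.
  by rewrite ger0_norm; lra.
have d3 : `|8 * m ^+ 2 * pcoord j x| <= 8 * m.
  have : `|m * pcoord j x| <= 1.
    rewrite -(@expr_le1 _ 2)// -normrX ger0_norm ?sqr_ge0// exprMn.
    apply: le_trans (ltW h); rewrite ler_wpM2l ?sqr_ge0// /normsq /pcoord.
    by case: ifP => _; rewrite ?lerDl ?lerDr sqr_ge0.
  rewrite (_ : 8 * m ^+ 2 * pcoord j x = 8 * m * (m * pcoord j x)); last by ring.
  have m8 : 0 <= 8 * m by rewrite mulr_ge0.
  by move=> hm; rewrite [leLHS]normrM (ger0_norm m8) ler_piMr.
rewrite /dcutoff -/s (_ : 128 * m = 2 * (8 * (8 * m))); last by ring.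
by rewrite [leLHS]normrM ler_pM// [leLHS]normrM ler_pM.
Qed.

End Cutoff.

(** * Square integrable fields and shrinking squares *)

Section Removal.
Variable R : realType.
Implicit Types (O D K Q : set (R * R)) (f g h psi : R * R -> R).

(** The weak form of a vanishing divergence on [O], tested with once
    continuously differentiable functions, so that products with cutoffs are
    admissible. The integral is over [D], on which the field is given,
    although the test functions live in [O]. *)
Definition divergence_free D O (T : 'I_2 -> R * R -> R) :=
  forall (psi : R * R -> R) (dpsi : 'I_2 -> R * R -> R) K,
  C1_on setT psi (dpsi ord0) (dpsi ord_max) -> compact K -> K `<=` O ->
  (forall x, ~ K x -> psi x = 0) ->
  (\int[@area R]_(x in D)
    (T ord0 x * dpsi ord0 x + T ord_max x * dpsi ord_max x)%:E = 0)%E.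

Lemma integrable_square D g : square_integrable D g ->
  (@area R).-integrable D (EFin \o (fun x => g x ^+ 2)).
Proof.
move=> [mg g2]; apply/integrableP; split.
  by apply/measurable_EFinP; exact: measurable_funX.
by under eq_integral do rewrite /= ger0_norm ?sqr_ge0//.
Qed.

Lemma integrable_of_square D g : measurable D -> (@area R D < +oo)%E ->
  square_integrable D g -> (@area R).-integrable D (EFin \o g).
Proof.
move=> mD fD sg; have [mg _] := sg; have i2 := integrable_square sg.
have i1 : (@area R).-integrable D (EFin \o (cst (1 : R))).
  apply: measurable_bounded_integrable => //.
  by exists 1; split; [exact: num_real|move=> y y1 x _; rewrite /= normr1 ltW].
apply: (@le_integrable _ _ _ (@area R) D mD _ (EFin \o (fun x => 1 + g x ^+ 2))).
- exact/measurable_EFinP.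
- move=> x _; rewrite /= lee_fin [leRHS]ger0_norm ?addr_ge0 ?sqr_ge0//.
  have := sqr_ge0 (`|g x| - 1); rewrite -[g x ^+ 2]real_normK ?num_real//.
  by have := normr_ge0 (g x); nra.
- exact: (@integrableD _ _ _ (@area R) D mD _ _ i1 i2).
Qed.

Lemma square_integrableM D g h (B : R) : measurable D -> (@area R D < +oo)%E ->
  square_integrable D g -> continuous h -> (forall x, `|h x| <= B) ->
  (@area R).-integrable D (EFin \o (fun x => g x * h x)).
Proof.
move=> mD fD sg ch hB; under eq_fun do rewrite mulrC.
apply: (bounded_integrableM mD _ (fun x _ => hB x)).
  apply: (measurable_funS measurableT) => //.
  by apply: measurable_fun_continuous_on => [|x _]; [exact: openT|exact: ch].
exact: integrable_of_square.
Qed.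

Lemma compact_support_bounded K f : continuous f -> compact K ->
  (forall x, ~ K x -> f x = 0) -> exists2 B : R, 0 <= B & forall x, `|f x| <= B.
Proof.
move=> cf cK f0; have [B B0 HB] := compact_fun_bounded cK (fun x _ => cf x).
exists B => // x; have [/HB//|/f0 ->] := pselect (K x).
by rewrite normr0.
Qed.

Lemma integrable_test D (T : 'I_2 -> R * R -> R) psi (dpsi : 'I_2 -> R * R -> R) K :
  measurable D -> (@area R D < +oo)%E -> (forall j, square_integrable D (T j)) ->
  C1_on setT psi (dpsi ord0) (dpsi ord_max) -> compact K ->
  (forall x, ~ K x -> psi x = 0) ->
  (@area R).-integrable D (EFin \o (fun x =>
    T ord0 x * dpsi ord0 x + T ord_max x * dpsi ord_max x)).
Proof.
move=> mD fD sT C cK psi0.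
have i1 j : (@area R).-integrable D (EFin \o (fun x => T j x * dpsi j x)).
  have cd : continuous (dpsi j) by move=> x; have [] := @C1_for_j _ _ _ _ C j x I.
  have dpsi0 x : ~ K x -> dpsi j x = 0.
    have [_ _ d] := @C1_for_j _ _ _ _ C j x I.
    exact: (derive_off_support cK psi0 d).
  have [B _ HB] := compact_support_bounded cd cK dpsi0.
  exact: square_integrableM HB.
exact: (@integrableD _ _ _ (@area R) D mD _ _ (i1 ord0) (i1 ord_max)).
Qed.

Lemma area_obox (a b c d : R) : a <= b -> c <= d ->
  @area R (obox a b c d) = ((b - a) * (d - c))%:E.
Proof.
move=> ab cd; rewrite /area /obox product_measure1E; [|exact: measurable_itv..].
have E (p q : R) : p <= q -> @lebesgue_measure R `]p, q[%classic = (q - p)%:E.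
  rewrite lebesgue_measure_itv /= lte_fin le_eqVlt => /orP[/eqP ->|->] //.
  by rewrite ltxx subrr.
by rewrite EFinM -!E.
Qed.

Lemma area_set1 (p : R * R) : @area R [set p] = 0%E.
Proof.
have -> : [set p] = [set p.1] `*` [set p.2].
  by apply/seteqP; split => [x ->//|[x1 x2] [/= -> ->]]; case: p.
rewrite /area product_measure1E; [|exact: measurable_set1..].
have E (t : R) : @lebesgue_measure R [set t] = 0%E by exact: lebesgue_measure_set1.
by rewrite [X in (X * _)%E]E mul0e.
Qed.

Lemma ae_neq (p : R * R) : {ae @area R, forall x, x <> p}.
Proof.
exists [set p]; split; [|exact: area_set1|].
- have -> : [set p] = [set p.1] `*` [set p.2].
    by apply/seteqP; split => [x ->//|[x1 x2] [/= -> ->]]; case: p.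
  by apply: measurableX; exact: measurable_set1.
- by move=> x /= /contrapT.
Qed.

Definition shrink (n : nat) : set (R * R) :=
  obox (- n.+1%:R^-1) n.+1%:R^-1 (- n.+1%:R^-1) n.+1%:R^-1.

Lemma normsq_gt0 (x : R * R) : x <> (0, 0) -> 0 < normsq x.
Proof.
move=> x0; rewrite lt_neqAle addr_ge0 ?sqr_ge0// andbT eq_sym.
apply/negP; rewrite paddr_eq0 ?sqr_ge0// !sqrf_eq0 => /andP[/eqP h1 /eqP h2].
by apply: x0; case: x h1 h2 => a b /= -> ->.
Qed.

Lemma near_normsq (c : R) (x : R * R) : 0 < c -> x <> (0, 0) ->
  \forall n \near \oo, c <= n.+1%:R ^+ 2 * normsq x.
Proof.
move=> c0 /normsq_gt0 s0; have sc0 : 0 < normsq x / c by rewrite divr_gt0.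
have [n _ nx] := near_infty_natSinv_lt (PosNum sc0).
exists n => // k /nx /= h; have k1 : 1 <= k.+1%:R :> R by rewrite ler1n.
have k0 : 0 < k.+1%:R :> R by rewrite ltr0n.
apply: le_trans (_ : k.+1%:R * normsq x <= _); last first.
  by rewrite ler_wpM2r ?(ltW s0)// expr2 ler_peMl ?(ltW k0).
by move: h; rewrite ltr_pdivlMr// ltr_pdivrMl// => /ltW.
Qed.

Lemma shrink_normsq n x : n.+1%:R ^+ 2 * normsq x < 1 -> shrink n x.
Proof.
set k := n.+1%:R => h; have k0 : 0 < k :> R by rewrite ltr0n.
have H t : k ^+ 2 * t ^+ 2 < 1 -> - k^-1 < t < k^-1.
  rewrite -exprMn -real_normK ?num_real// expr_lt1// normrM gtr0_norm// => kt.
  by rewrite -ltr_norml -[k^-1]mulr1 ltr_pdivlMl.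
split; rewrite /= in_itv /= H//; apply: le_lt_trans h; rewrite ler_wpM2l ?sqr_ge0//.
  by rewrite lerDl sqr_ge0.
by rewrite lerDr sqr_ge0.
Qed.

Lemma shrink_lt2 n x : shrink n x -> n.+1%:R ^+ 2 * normsq x < 2.
Proof.
set k := n.+1%:R; have k0 : 0 < k :> R by rewrite ltr0n.
have H t : - k^-1 < t < k^-1 -> k ^+ 2 * t ^+ 2 < 1.
  rewrite -ltr_norml -exprMn -real_normK ?num_real// expr_lt1//.
  by rewrite normrM gtr0_norm// -[k^-1]mulr1 ltr_pdivlMl.
move=> [/=]; rewrite !in_itv /= => /H h1 /H h2.
by rewrite /normsq mulrDr; lra.
Qed.

(** Dominated convergence on squares that shrink to the origin. *)
Lemma integral_shrink_cvg0 D g : measurable D ->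
  (@area R).-integrable D (EFin \o g) ->
  (\int[@area R]_(x in D `&` shrink n) (g x)%:E)%E @[n --> \oo] --> 0%E.
Proof.
move=> mD ig; have mQ n : measurable (shrink n) by exact: measurable_obox.
under eq_fun do rewrite integral_mkcondr.
have [] := @dominated_convergence _ _ _ (@area R) D mD
  (fun n => (EFin \o g) \_ (shrink n)) (cst 0%E) (abse \o (EFin \o g)).
- move=> n; apply/(measurable_restrict _ (mQ n) mD).
  exact: (measurable_funS mD (@subIsetl _ _ _) (measurable_int _ ig)).
- exact: measurable_cst.
- have := ae_neq (0, 0); apply: ae_areaS => x x0 Dx.
  apply: cvg_near_cst; near=> n; rewrite patchE ifF//; apply/negP.
  move=> /set_mem/shrink_lt2; rewrite ltNge => /negP; apply.
  by near: n; apply: near_normsq.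
- exact: integrable_abse.
- apply: aeW => x n Dx; rewrite patchE /=; case: ifP => // _.
  by rewrite abse0.
by rewrite integral0.
Unshelve. all: by end_near. Qed.

End Removal.

(** * Removing the origin from a divergence equation *)

Section RemovableOrigin.
Variable R : realType.

(** Weighted Young inequality; the parameter [delta] is arbitrarily small in
    the end, which spares the Cauchy-Schwarz inequality. *)
Lemma young_le (delta a k t : R) : 0 < delta ->
  a * k * t <= delta * k ^+ 2 / 2 + a ^+ 2 / (2 * delta) * t ^+ 2.
Proof.
move=> d0; rewrite -subr_ge0.
rewrite (_ : _ - _ = (delta * k - a * t) ^+ 2 / (2 * delta)).
  by rewrite divr_ge0 ?sqr_ge0// mulr_ge0// ltW.
by field; rewrite gt_eqF.
Qed.

(** A point has zero capacity in the plane: the energy of the cutoffs stays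
    bounded while their gradients concentrate on shrinking squares, where the
    square integrable field has vanishing energy. *)
Lemma removable_origin (D : set (R * R)) (T : 'I_2 -> R * R -> R) :
  open D -> (@area R D < +oo)%E -> (forall j, square_integrable D (T j)) ->
  divergence_free D (D `\` [set (0, 0)]) T -> divergence_free D D T.
Proof.
move=> oD fD sT dfO psi dpsi K C cK KD psi0.
have mD := open_measurable2 oD.
have cpsi : continuous psi by move=> x; have [] := C x I.
have [M M0 HM] := compact_support_bounded cpsi cK psi0.
have mcont (h : R * R -> R) : continuous h -> measurable_fun D h.
  move=> ch; apply: (measurable_funS measurableT) => //.
  by apply: measurable_fun_continuous_on => [|x _]; [exact: openT|exact: ch].
have iT2 (c : R) : (@area R).-integrable D
    (EFin \o (fun x => c * (T ord0 x ^+ 2 + T ord_max x ^+ 2))).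
  apply: (@bounded_integrableM _ D (cst c) _ `|c| mD) => //.
  exact: (@integrableD _ _ _ (@area R) D mD _ _
    (integrable_square (sT ord0)) (integrable_square (sT ord_max))).
pose J x := T ord0 x * dpsi ord0 x + T ord_max x * dpsi ord_max x.
have iJ : (@area R).-integrable D (EFin \o J) by exact: integrable_test psi0.
pose k n : R := n.+1%:R.
pose eta n := cutoff (k n); pose deta n := dcutoff (k n).
have k0 n : 0 < k n by rewrite ltr0n.
have Ce n : C1_on setT (eta n) (deta n ord0) (deta n ord_max) by exact: C1_cutoff.
have ce n : continuous (eta n) by move=> x; have [] := Ce n x I.
have cde n j : continuous (deta n j).
  by move=> x; have [] := @C1_for_j _ _ _ _ (Ce n) j x I.
pose E n x := psi x * (T ord0 x * deta n ord0 x + T ord_max x * deta n ord_max x).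
have iE n : (@area R).-integrable D (EFin \o E n).
  have i1 j : (@area R).-integrable D (EFin \o (fun x => T j x * deta n j x)).
    apply: (square_integrableM mD fD (sT j) (cde n j)) => x.
    by apply: dcutoff_bound; exact: ltW.
  have := bounded_integrableM mD (mcont _ cpsi) (fun x _ => HM x)
    (@integrableD _ _ _ (@area R) D mD _ _ (i1 ord0) (i1 ord_max)).
  exact.
have iEJ n : (@area R).-integrable D (EFin \o (fun x => eta n x * J x)).
  apply: (@bounded_integrableM _ D (eta n) J 1 mD (mcont _ (ce n)) _ iJ) => x _.
  by have /andP[e0 e1] := cutoff_itv (k n) x; rewrite ger0_norm.
have EJE n : (\int[@area R]_(x in D) (eta n x * J x)%:E =
    - \int[@area R]_(x in D) (E n x)%:E)%E.
  (* The cutoff vanishes near the origin, so the product has support in a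
     compact set of the punctured set. *)
  pose K' := K `&` [set x | 4^-1 <= k n ^+ 2 * normsq x].
  have cK' : compact K'.
    apply: compact_closedI => //.
    apply: (@preimage_closed _ _ (fun x => k n ^+ 2 * normsq x) [set t | 4^-1 <= t]).
      have Cn := C1_mul (@C1_cst R setT (k n ^+ 2)) (@C1_normsq R setT).
      by move=> x _; have [] := Cn x I.
    exact: closed_ge.
  have K'O : K' `<=` D `\` [set (0, 0)].
    move=> x [/KD Dx /= hx]; split => //= x0; move: hx.
    by rewrite x0 /normsq expr0n addr0 mulr0 leNgt invr_gt0 ltr0n.
  have off x : ~ K' x -> eta n x * psi x = 0.
    move=> K'x; have [Kx|/psi0 ->] := pselect (K x); last by rewrite mulr0.
    rewrite /eta cutoff_near0 ?mul0r//; rewrite leNgt; apply/negP => h.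
    by apply: K'x; split => //=; exact: ltW.
  have := dfO _ (fun j x => deta n j x * psi x + eta n x * dpsi j x) K'
    (C1_mul (Ce n) C) cK' K'O off.
  have -> : (fun x => (T ord0 x * (deta n ord0 x * psi x + eta n x * dpsi ord0 x) +
      T ord_max x * (deta n ord_max x * psi x + eta n x * dpsi ord_max x))%:E) =
      (fun x => (eta n x * J x)%:E + (E n x)%:E)%E.
    by apply/funext => x; rewrite -EFinD /J /E; congr EFin; ring.
  rewrite (@integralD _ _ _ (@area R) D mD _ _ (iEJ n) (iE n)) /=.
  have := @integrable_fin_num _ _ _ (@area R) D mD _ (iEJ n).
  have := @integrable_fin_num _ _ _ (@area R) D mD _ (iE n).
  move=> /fineK <- /fineK <-; rewrite -EFinD -EFinN => -[] /eqP.
  by rewrite addr_eq0 => /eqP ->.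
have cvgJ : (\int[@area R]_(x in D) (eta n x * J x)%:E)%E @[n --> \oo] -->
    (\int[@area R]_(x in D) (J x)%:E)%E.
  have [] := @dominated_convergence _ _ _ (@area R) D mD
    (fun n => EFin \o (fun x => eta n x * J x)) (EFin \o J) (abse \o (EFin \o J)).
  - by move=> n; exact: measurable_int (iEJ n).
  - exact: measurable_int iJ.
  - have := @ae_neq R (0, 0); apply: ae_areaS => x x0 Dx.
    apply: cvg_near_cst; near=> n; rewrite /= /eta cutoff_far ?mul1r//.
    by near: n; exact: near_normsq.
  - exact: integrable_abse.
  - apply: aeW => x n _; rewrite /= lee_fin normrM ler_piMl//.
    by have /andP[e0 e1] := cutoff_itv (k n) x; rewrite ger0_norm.
  by [].
have bound delta n : 0 < delta -> (`|\int[@area R]_(x in D) (E n x)%:E| <=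
    (4 * delta)%:E + \int[@area R]_(x in D `&` shrink n)
      (((128 * M) ^+ 2 / (2 * delta)) * (T ord0 x ^+ 2 + T ord_max x ^+ 2))%:E)%E.
  move=> d0; have mQ : measurable (shrink n : set (R * R)) by exact: measurable_obox.
  have mDQ : measurable (D `&` shrink n) by exact: measurableI.
  have DQD : D `&` shrink n `<=` D by exact: subIsetl.
  set c := _ / _; pose g x := c * (T ord0 x ^+ 2 + T ord_max x ^+ 2).
  have ET x : `|E n x| <= delta * k n ^+ 2 + g x.
    have HT j : 128 * M * k n * `|T j x| <= delta * k n ^+ 2 / 2 + c * T j x ^+ 2.
      by rewrite -[T j x ^+ 2]real_normK ?num_real//; exact: young_le.
    have HD j : `|T j x * deta n j x| <= `|T j x| * (128 * k n).
      by rewrite normrM ler_wpM2l//; apply: dcutoff_bound; exact: ltW.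
    rewrite /E normrM.
    apply: le_trans (ler_pM _ _ (HM x) (ler_normD _ _)) _ => //.
    apply: le_trans (ler_wpM2l M0 (lerD (HD ord0) (HD ord_max))) _.
    by have := HT ord0; have := HT ord_max; rewrite /g; lra.
  apply: le_trans (@le_abse_integral _ _ _ (@area R) _ _ mD (measurable_int _ (iE n))) _.
  rewrite (@integral_support _ (D `&` shrink n) D _ DQD); last first.
    move=> x Dx nQ; rewrite /= /E /deta.
    have far : 1 <= k n ^+ 2 * normsq x.
      by rewrite leNgt; apply/negP => h; apply: nQ; split=> //; exact: shrink_normsq.
    by rewrite !dcutoff_far// !mulr0 addr0 mulr0 normr0.
  have ig : (@area R).-integrable (D `&` shrink n) (EFin \o g).
    by apply: integrableS (iT2 c).
  have mg := measurable_int _ ig.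
  apply: (@le_trans _ _ (\int[@area R]_(x in D `&` shrink n)
      ((cst (delta * k n ^+ 2)%:E x) + (g x)%:E))%E).
    apply: ge0_le_integral => //.
    - apply: measurableT_comp => //.
      exact: (measurable_funS mD DQD (measurable_int _ (iE n))).
    - by apply: emeasurable_funD => //; exact: measurable_cst.
    - by move=> x _; rewrite /= lee_fin ET.
  rewrite (@ge0_integralD _ _ _ (@area R) _ mDQ)//; last 2 first.
  - by move=> x _; rewrite /= lee_fin mulr_ge0 ?sqr_ge0// ltW.
  - move=> x _; rewrite /= lee_fin mulr_ge0 ?addr_ge0 ?sqr_ge0//.
    by rewrite divr_ge0 ?sqr_ge0// mulr_ge0// ltW.
  rewrite leeD2r// integral_cst//.
  have -> : (4 * delta)%:E = ((delta * k n ^+ 2)%:E * @area R (shrink n))%E.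
    have ki : 0 < (k n)^-1 by rewrite invr_gt0.
    have kk : - (k n)^-1 <= (k n)^-1 by rewrite -subr_ge0 opprK addr_ge0 ?ltW.
    rewrite (area_obox kk kk) -EFinM; congr EFin; field.
    by rewrite gt_eqF.
  rewrite lee_wpmul2l// ?lee_fin ?mulr_ge0 ?sqr_ge0 ?(ltW d0)//.
  by apply: le_measure; rewrite ?inE//; exact: subIsetr.
(* The weight is e / 4 because the square [shrink n] has area 4 / n.+1 ^ 2,
   so that the first term of [bound] equals e. *)
apply/eqP; rewrite -abse_eq0 eq_le abse_ge0 andbT.
apply/lee_addgt0Pr => e e0; rewrite add0e.
have d0 : 0 < e / 4 by rewrite divr_gt0.
set aJ := (\int[@area R]_(x in D) (J x)%:E)%E in cvgJ *.
pose om n := (\int[@area R]_(x in D `&` shrink n)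
  (((128 * M) ^+ 2 / (2 * (e / 4))) * (T ord0 x ^+ 2 + T ord_max x ^+ 2))%:E)%E.
have om0 : om n @[n --> \oo] --> 0%E.
  exact: (integral_shrink_cvg0 mD (iT2 _)).
have L : (e%:E + om n)%E @[n --> \oo] --> (e%:E + 0)%E.
  by apply: cvgeD => //; exact: cvg_cst.
rewrite adde0 in L.
have A : (`|\int[@area R]_(x in D) (eta n x * J x)%:E|)%E @[n --> \oo] --> `|aJ|%E.
  exact: cvg_abse cvgJ.
rewrite -(cvg_lim _ A)// -(cvg_lim _ L)//; apply: lee_lim.
- by apply/cvg_ex; eexists; exact: A.
- by apply/cvg_ex; eexists; exact: L.
apply: nearW => n; rewrite EJE abseN.
by have := bound (e / 4) n d0; rewrite mulrC divfK// pnatr_eq0.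
Unshelve. all: by end_near. Qed.

End RemovableOrigin.

(** * Smooth fields with vanishing divergence *)

Section ClassicalFields.
Variable R : realType.

(** Inside the interval [r] coincides, near each point, with a function that
    is smooth on an open set. *)
Lemma smooth_on_derivable (r : R -> R) n (t : R) :
  smooth_on `]0, 1]%classic r -> 0 < t < 1 -> derivable (derive1n n r) t 1.
Proof.
move=> [U [g [oU sU rg dg]]] t01.
have itv (s : R) : 0 < s < 1 -> \forall z \near s, 0 < z < 1.
  move=> s01; have : nbhs s `]0, 1[%classic.
    by apply: open_nbhs_nbhs; split; [exact: interval_open|rewrite /= in_itv].
  by apply: filterS => z; rewrite /= in_itv.
have E k (s : R) : 0 < s < 1 -> derive1n k r s = derive1n k g s.
  elim: k s => [|k IH] s s01.
    by apply: rg; rewrite inE /= in_itv /=; case/andP: s01 => -> /ltW ->.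
  rewrite !derive1nS !derive1E; apply: near_eq_derive.
  by apply: filterS (itv s s01) => z; exact: IH.
have /dg : U t by apply: sU; rewrite /= in_itv /=; case/andP: t01 => -> /ltW ->.
move=> /(_ n); apply: near_eq_derivable.
by apply: filterS (itv t t01) => z z01; rewrite E.
Qed.

Lemma smooth_on_C1 (r : R -> R) n (t : R) :
  smooth_on `]0, 1]%classic r -> 0 < t < 1 ->
  is_derive t 1 (derive1n n r) (derive1n n.+1 r t) /\
  {for t, continuous (derive1n n r)}.
Proof.
move=> sr t01; have d : derivable (derive1n n r) t 1 by exact: smooth_on_derivable.
split.
  by rewrite derive1nS derive1E; exact: derivableP.
by apply/differentiable_continuous/derivable1_diffP.
Qed.

(** The pointwise counterpart of [divergence_free]. *)
Definition solenoidal (O : set (R * R)) (T : 'I_2 -> R * R -> R) :=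
  exists dT : 'I_2 -> 'I_2 -> R * R -> R,
    (forall j, C1_on O (T j) (dT j ord0) (dT j ord_max)) /\
    (forall x, O x -> dT ord0 ord0 x + dT ord_max ord_max x = 0).

Lemma solenoidal_divergence_free (D O : set (R * R)) (T : 'I_2 -> R * R -> R) :
  open O -> O `<=` D -> solenoidal O T -> divergence_free D O T.
Proof.
move=> oO OD [dT [CT div]] psi dpsi K C cK KO psi0.
have dpsi0 i x : ~ K x -> dpsi i x = 0.
  by have [_ _ d] := @C1_for_j _ _ _ _ C i x I; exact: (derive_off_support cK psi0 d).
pose F j i x := dT j i x * psi x + T j x * dpsi i x.
have CF j : C1_on setT (fun x => T j x * psi x) (F j ord0) (F j ord_max).
  apply: (C1_extend oO cK KO (C1_mul (CT j) (C1_sub (@subsetT _ O) C))).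
  - by move=> y Ky; rewrite psi0// mulr0.
  - by move=> y Ky; rewrite psi0// dpsi0// !mulr0 addr0.
  - by move=> y Ky; rewrite psi0// dpsi0// !mulr0 addr0.
have F0 j i y : ~ K y -> F j i y = 0.
  by move=> Ky; rewrite /F psi0// dpsi0// !mulr0 addr0.
have Tpsi0 j y : ~ K y -> T j y * psi y = 0 by move=> /psi0 ->; rewrite mulr0.
have iF j i : (@area R).-integrable setT (EFin \o F j i).
  apply: compact_support_integrable cK (F0 j i).
  by move=> y; have [_ cF _] := @C1_for_j _ _ _ (F j) (CF j) i y I.
have I0 j i := integral_partial_eq0 i (CF j) cK (Tpsi0 j).
rewrite -(@integral_support _ D setT)//; last first.
  by move=> y _ Dy; rewrite !dpsi0 ?mulr0 ?addr0// => /KO/OD.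
transitivity (\int[@area R]_x ((F ord0 ord0 x)%:E + (F ord_max ord_max x)%:E))%E.
  apply: eq_integral => x _; rewrite -EFinD /F; congr EFin.
  have [Kx|Kx] := pselect (K x); last by rewrite psi0// !dpsi0// !mulr0 !addr0.
  have /eqP := div x (KO _ Kx); rewrite addr_eq0 => /eqP ->.
  by ring.
rewrite (@integralD _ _ _ (@area R) setT measurableT _ _ (iF _ _) (iF _ _)) /=.
by rewrite !I0 adde0.
Qed.

Lemma solenoidal_pair (O : set (R * R)) (T : 'I_2 -> R * R -> R)
    (a b c d : R * R -> R) :
  C1_on O (T ord0) a b -> C1_on O (T ord_max) c d ->
  (forall x, O x -> a x + d x = 0) -> solenoidal O T.
Proof.
move=> T0 T1 div; exists (fun j i =>
  if j == ord0 then if i == ord0 then a else b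
  else if i == ord0 then c else d); split=> // j.
by have [->|->] := ord2P j.
Qed.

Lemma solenoidal_measurable (O : set (R * R)) (T : 'I_2 -> R * R -> R) j :
  open O -> solenoidal O T -> measurable_fun O (T j).
Proof.
move=> oO [dT [CT _]]; apply: measurable_fun_continuous_on => // x Ox.
by have [] := CT j x Ox.
Qed.

End ClassicalFields.

(** * Polar coordinates without the angle *)

Section Polar.
Variable R : realType.

Definition radius (x : R * R) : R := Num.sqrt (normsq x).
Definition iradius (x : R * R) : R := (radius x)^-1.
Definition punctured : set (R * R) := @unit_disc R `\` [set (0, 0)].

Lemma unit_discE : @unit_disc R = [set x | normsq x < 1]. Proof. by []. Qed.

Lemma open_unit_disc : open (@unit_disc R).
Proof.
rewrite unit_discE; apply: (@open_comp _ _ (@normsq R) [set t | t < 1]).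
  by move=> x _; have [] := @C1_normsq R setT x I.
exact: open_lt.
Qed.

Lemma open_punctured : open punctured.
Proof.
apply: openI; first exact: open_unit_disc.
apply: closed_openC; apply: compact_closed; first exact: plane_hausdorff.
exact: compact_set1.
Qed.

Lemma area_unit_disc : (@area R (@unit_disc R) < +oo)%E.
Proof.
apply: le_lt_trans (@area_cbox_lty R (- 1) 1 (- 1) 1).
apply: le_measure; rewrite ?inE.
- exact: (open_measurable2 open_unit_disc).
- exact: measurable_cbox.
- move=> x; rewrite unit_discE /normsq /= => h.
  have a2 : x.1 ^+ 2 <= 1 by have := sqr_ge0 x.2; lra.
  have b2 : x.2 ^+ 2 <= 1 by have := sqr_ge0 x.1; lra.
  by split; rewrite /= in_itv /= -ler_norml -(@expr_le1 _ 2)// -normrX ger0_norm ?sqr_ge0.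
Qed.

Lemma punctured_radius x : punctured x -> 0 < radius x < 1.
Proof.
move=> [Dx /= x0]; have s0 := normsq_gt0 x0.
by rewrite /radius sqrtr_gt0 s0 /= -sqrtr1 ltr_sqrt.
Qed.

Lemma radius_sqr x : radius x ^+ 2 = normsq x.
Proof. by rewrite sqr_sqrtr// addr_ge0 ?sqr_ge0. Qed.

Lemma radiusK x : punctured x -> radius x * iradius x = 1.
Proof. by move=> /punctured_radius/andP[h _]; rewrite mulfV// gt_eqF. Qed.

(** The form in which the relation between the coordinates and the radius is
    used as a rewriting rule for monomials. *)
Lemma iradius_sqr x : punctured x ->
  x.1 ^+ 2 * iradius x ^+ 2 = 1 - x.2 ^+ 2 * iradius x ^+ 2.
Proof.
move=> px; have h := radiusK px; have s := radius_sqr x.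
apply/eqP; rewrite -subr_eq0 opprB addrA -mulrDl -/(normsq x) -s -exprMn h.
by rewrite expr1n subrr.
Qed.

Lemma C1_radius : C1_on punctured radius (fun x => x.1 * iradius x)
  (fun x => x.2 * iradius x).
Proof.
have C := @C1_comp _ punctured [set t | 0 < t] Num.sqrt
  (fun t => (2 * Num.sqrt t)^-1) _ _ _ _ _ _ (@C1_normsq R punctured).
have {}C := C (fun t t0 => is_derive1_sqrt t0).
have pos x : punctured x -> 0 < normsq x by move=> [_ /=]; exact: normsq_gt0.
have ct (t : R) : [set t : R | 0 < t] t ->
    {for t, continuous (fun t : R => (2 * Num.sqrt t)^-1)}.
  move=> /= t0; apply: continuousV; first by rewrite mulf_neq0// gt_eqF ?sqrtr_gt0.
  by apply: continuousM; [exact: cst_continuous|exact: sqrt_continuous].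
have {}C := C ct pos.
apply: C1_ext C => [|x _|x px|x px] //; first exact: open_punctured.
- rewrite -/(radius x) invfM /iradius /pcoord /=.
  by rewrite mulrA [_ * 2]mulrC mulrA divff// mul1r mulrC.
- rewrite -/(radius x) invfM /iradius /pcoord /=.
  by rewrite mulrA [_ * 2]mulrC mulrA divff// mul1r mulrC.
Qed.

Lemma C1_iradius : C1_on punctured iradius (fun x => - x.1 * iradius x ^+ 3)
  (fun x => - x.2 * iradius x ^+ 3).
Proof.
have r0 x : punctured x -> radius x != 0.
  by move=> /punctured_radius/andP[h _]; rewrite gt_eqF.
apply: C1_ext (C1_inv r0 C1_radius) => [|x _|x px|x px] //; first exact: open_punctured.
- by rewrite -exprVn -/(iradius x); ring.
- by rewrite -exprVn -/(iradius x); ring.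
Qed.

Lemma C1_radial (h h' : R -> R) :
  (forall t : R, 0 < t < 1 -> is_derive t 1 h (h' t)) ->
  (forall t : R, 0 < t < 1 -> {for t, continuous h'}) ->
  C1_on punctured (fun x => h (radius x))
    (fun x => h' (radius x) * (x.1 * iradius x))
    (fun x => h' (radius x) * (x.2 * iradius x)).
Proof.
move=> dh ch; apply: (@C1_comp _ _ [set t | 0 < t < 1]) => //.
  exact: punctured_radius.
exact: C1_radius.
Qed.

(** The pair (cos (k theta), sin (k theta)) and its derivatives, without
    reference to a branch of the angle. *)
Definition angular (k : R) (C S : R * R -> R) :=
  [/\ C1_on punctured C (fun x => k * S x * x.2 * iradius x ^+ 2)
        (fun x => - (k * S x * x.1 * iradius x ^+ 2)),
      C1_on punctured S (fun x => - (k * C x * x.2 * iradius x ^+ 2))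
        (fun x => k * C x * x.1 * iradius x ^+ 2) &
      forall x, punctured x -> C x ^+ 2 + S x ^+ 2 = 1].

(** Rotating the pair by a quarter of a turn: this exchanges the two
    components of a radial map, so that the two rows of its stress can be
    treated at once. *)
Lemma angular_rot k C S : angular k C S -> angular k S (fun x => - C x).
Proof.
move=> [cC cS h]; split=> //; last by move=> x px; rewrite sqrrN addrC h.
- apply: C1_ext cS => [|x _|x px|x px] //; first exact: open_punctured.
  + by ring.
  + by ring.
- apply: C1_ext (C1_opp cC) => [|x _|x px|x px] //; first exact: open_punctured.
  by rewrite opprK.
Qed.

Fixpoint cosn n (x : R * R) : R :=
  if n is k.+1 then (x.1 * cosn k x - x.2 * sinn k x) * iradius x else 1
with sinn n (x : R * R) : R :=
  if n is k.+1 then (x.2 * cosn k x + x.1 * sinn k x) * iradius x else 0.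

(** Induction on [n] with the addition formulas, the induction step being a
    polynomial identity modulo [iradius_sqr]. *)
Lemma angular_cosn n : angular n%:R (cosn n) (sinn n).
Proof.
elim: n => [|n [cC cS h]].
  split=> [||x _]; last by rewrite /= expr1n expr0n addr0.
  - apply: C1_ext (@C1_cst R punctured 1) => [|x _|x _|x _] //=; first exact: open_punctured.
    + by rewrite !mul0r.
    + by rewrite !mul0r oppr0.
  - apply: C1_ext (@C1_cst R punctured 0) => [|x _|x _|x _] //=; first exact: open_punctured.
    + by rewrite !mul0r oppr0.
    + by rewrite !mul0r.
have X := @C1_fst R punctured; have Y := @C1_snd R punctured.
split=> [||x px].
- have Q := C1_mul (C1_add (C1_mul X cC) (C1_opp (C1_mul Y cS))) C1_iradius.
  apply: C1_ext Q => [|x _|x px|x px] //=; first exact: open_punctured.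
  + have e := iradius_sqr px; rewrite -natr1; ring: e.
  + have e := iradius_sqr px; rewrite -natr1; ring: e.
- have Q := C1_mul (C1_add (C1_mul Y cC) (C1_mul X cS)) C1_iradius.
  apply: C1_ext Q => [|x _|x px|x px] //=; first exact: open_punctured.
  + have e := iradius_sqr px; rewrite -natr1; ring: e.
  + have e := iradius_sqr px; rewrite -natr1; ring: e.
- have e := iradius_sqr px.
  have {}h : cosn n x ^+ 2 = 1 - sinn n x ^+ 2 by rewrite -(h x px) addrK.
  by rewrite /=; ring: e h.
Qed.

Lemma polar_decomposition x : punctured x -> exists theta : R,
  x = (radius x * cos theta, radius x * sin theta).
Proof.
move=> px; have /andP[R0 _] := punctured_radius px.
pose a := x.1 / radius x; pose b := x.2 / radius x.
have ab : a ^+ 2 + b ^+ 2 = 1.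
  rewrite /a /b !exprMn -mulrDl exprVn -/(normsq x) -radius_sqr mulfV//.
  by rewrite expf_neq0// gt_eqF.
have a1 : -1 <= a <= 1.
  rewrite -ler_norml -(@expr_le1 _ 2)// -normrX ger0_norm ?sqr_ge0//.
  by have := sqr_ge0 b; lra.
have xa : x.1 = radius x * a by rewrite mulrCA mulfV ?mulr1// gt_eqF.
have xb : x.2 = radius x * b by rewrite mulrCA mulfV ?mulr1// gt_eqF.
have b2 : Num.sqrt (1 - a ^+ 2) = `|b| by rewrite -ab [_ + b ^+ 2]addrC addrK sqrtr_sqr.
have ca : cos (acos a) = a by apply: acosK; rewrite in_itv.
have [b0|b0] := leP 0 b.
  by exists (acos a); rewrite ca sin_acos// b2 ger0_norm// -xa -xb; case: (x).
exists (- acos a); rewrite cosN sinN ca sin_acos// b2 ltr0_norm// opprK -xa -xb.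
by case: (x).
Qed.

Lemma cosn_polar (t theta : R) n : 0 < t -> let x := (t * cos theta, t * sin theta) in
  cosn n x = cos (n%:R * theta) /\ sinn n x = sin (n%:R * theta).
Proof.
move=> t0 x; have E : iradius x = t^-1.
  rewrite /iradius /radius /normsq /= !exprMn -mulrDr cos2Dsin2 mulr1.
  by rewrite sqrtr_sqr gtr0_norm.
elim: n => [|n [IHc IHs]] /=; first by rewrite mul0r cos0 sin0.
have -> : n.+1%:R * theta = n%:R * theta + theta by rewrite -natr1 mulrDl mul1r.
rewrite IHc IHs E cosD sinD.
by split; field; rewrite gt_eqF.
Qed.

End Polar.

(** * The stress of a radial map *)

Section RadialStress.
Variables (R : realType) (rho r : R -> R) (M : nat).
Hypothesis rho_smooth : smooth rho.
Hypothesis r_smooth : smooth_on `]0, 1]%classic r.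
Hypothesis r_ode : forall t : R, 0 < t < 1 -> radial_ode rho M r t.

Let k : R := M%:R.
Let d := radial_det M r.
Let O := @punctured R.

(** The second component of the pair determines the derivatives of the first
    one. *)
Definition dangular (S : R * R -> R) (j : 'I_2) (x : R * R) : R :=
  if j == ord0 then k * S x * x.2 * iradius x ^+ 2
  else - (k * S x * x.1 * iradius x ^+ 2).

(** The gradient of the function [r (radius x) * C x]. The second component
    of the radial map corresponds to the rotated pair [S], [- C]. *)
Definition radial_grad (C S : R * R -> R) (j : 'I_2) (x : R * R) : R :=
  derive1 r (radius x) * (pcoord j x * iradius x) * C x +
  r (radius x) * dangular S j x.

(** The row of [xi + rho' (det xi) cof xi] that belongs to the component [r
    (radius x) * C x]; the cofactor entries are those of the gradient of the
    other component. *)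
Definition radial_stress (C S : R * R -> R) (j : 'I_2) (x : R * R) : R :=
  let p := derive1 rho (d (radius x)) in
  if j == ord0
  then radial_grad C S ord0 x + p * radial_grad S (fun y => - C y) ord_max x
  else radial_grad C S ord_max x - p * radial_grad S (fun y => - C y) ord0 x.

Lemma C1_r n : C1_on O (fun x => derive1n n r (radius x))
    (fun x => derive1n n.+1 r (radius x) * (x.1 * iradius x))
    (fun x => derive1n n.+1 r (radius x) * (x.2 * iradius x)).
Proof.
by apply: C1_radial => t t01; [have [] := smooth_on_C1 n r_smooth t01|
  have [] := smooth_on_C1 n.+1 r_smooth t01].
Qed.

Lemma C1_radial_map C S : angular k C S ->
  C1_on O (fun x => r (radius x) * C x) (radial_grad C S ord0)
    (radial_grad C S ord_max).
Proof. by move=> [cC _ _]; exact: C1_mul (C1_r 0) cC. Qed.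

(** The derivative of the radial determinant [d], in a form that is visibly
    continuous. *)
Definition ddet (t : R) : R :=
  k * (derive1 r t ^+ 2 + r t * derive1n 2 r t) * t^-1
  - k * r t * derive1 r t * (t^-1 * t^-1).

Lemma is_derive_det (t : R) : 0 < t < 1 -> is_derive t 1 d (ddet t).
Proof.
move=> t01; have [d0 _] := smooth_on_C1 0 r_smooth t01.
have [d1 _] := smooth_on_C1 1 r_smooth t01.
have t0 : t != 0 by rewrite gt_eqF//; case/andP: t01.
have di : is_derive t 1 (fun s : R => s^-1) (- t ^- 2).
  apply: is_derive_eq; first by apply: is_deriveV.
  by rewrite /GRing.scale /= mulr1.
have D := is_deriveM (is_deriveM (is_deriveM (is_derive_cst k t 1) d0) d1) di.
apply: is_derive_eq D _.
by rewrite /ddet /GRing.scale /= !fctE; field.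
Qed.

Lemma C1_drho : C1_on O (fun x => derive1 rho (d (radius x)))
  (fun x => derive1n 2 rho (d (radius x)) * ddet (radius x) * (x.1 * iradius x))
  (fun x => derive1n 2 rho (d (radius x)) * ddet (radius x) * (x.2 * iradius x)).
Proof.
apply: (@C1_radial _ (fun t => derive1 rho (d t))
  (fun t => derive1n 2 rho (d t) * ddet t)) => t t01.
  apply: (@is_derive1_comp _ (derive1 rho) d); last exact: is_derive_det.
  exact: smooth_is_derive (smooth_derive1 rho_smooth).
have [_ c0] := smooth_on_C1 0 r_smooth t01.
have [_ c1] := smooth_on_C1 1 r_smooth t01.
have [_ c2] := smooth_on_C1 2 r_smooth t01.
have ck : {for t, continuous (fun=> k)} by exact: cst_continuous.
have ci : {for t, continuous (fun s : R => s^-1)}.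
  by apply: continuousV; [rewrite gt_eqF//; case/andP: t01|exact: cvg_id].
apply: continuousM.
  apply: (@continuous_comp _ _ _ d (derive1n 2 rho)); last first.
    have c : continuous (derive1n 2 rho).
      by apply: smooth_continuous; exact: smooth_derive1n.
    exact: c.
  have dd := is_derive_det t01.
  by apply/differentiable_continuous/derivable1_diffP; exact: ex_derive.
apply: continuousB; apply: continuousM => //.
- apply: continuousM => //; apply: continuousD; apply: continuousM => //.
- by apply: continuousM => //; apply: continuousM.
- exact: continuousM.
Qed.

(** The radial equation divided by the radius, oriented for the monomial that
    the divergence of the stress produces. *)
Lemma ode_iradius x : O x -> k ^+ 2 * r (radius x) * iradius x ^+ 2 =
  derive1 r (radius x) * iradius x + derive1n 2 r (radius x) +
  k * (derive1n 2 rho (d (radius x)) * ddet (radius x)) * r (radius x) * iradius x.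
Proof.
move=> Ox; have t01 := punctured_radius Ox; have dd := is_derive_det t01.
have E : derive1 d (radius x) = ddet (radius x).
  by rewrite derive1E; exact: derive_val.
have := r_ode t01; rewrite /radial_ode -/d E -/k -/(iradius x).
move=> /(congr1 (fun t => t * iradius x)) => E'.
by have h := radiusK Ox; rewrite [iradius x ^+ 2]expr2 mulrA E'; ring: h.
Qed.

Lemma radial_det_grad C S x : angular k C S -> O x ->
  radial_grad C S ord0 x * radial_grad S (fun y => - C y) ord_max x -
  radial_grad C S ord_max x * radial_grad S (fun y => - C y) ord0 x = d (radius x).
Proof.
move=> [_ _ CS] Ox; have e := iradius_sqr Ox.
have h : C x ^+ 2 = 1 - S x ^+ 2 by rewrite -(CS x Ox) addrK.
rewrite /radial_grad /dangular /pcoord /= /d /radial_det -/(iradius x) -/k.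
by ring: e h.
Qed.

(** Up to the factor 1 / R, the Laplacian of [r (radius x) * C x] is [C x]
    times the linear part of the radial equation. The rows of the cofactor
    matrix are divergence free, so the other contribution is the pairing of
    the gradient of rho'(d) with the cofactor row. That gradient is radial,
    and the radial part of the cofactor row is the angular derivative of the
    other component, again a multiple of [C x]. *)
Lemma radial_stress_solenoidal C S : angular k C S ->
  solenoidal O (radial_stress C S).
Proof.
move=> [cC cS _].
have X := @C1_fst R O; have Y := @C1_snd R O; have I := @C1_iradius R.
have K := @C1_cst R O k.
have r0 := C1_r 0; have r1 := C1_r 1; have P := C1_drho.
have XI := C1_mul X I; have YI := C1_mul Y I; have II := C1_mul I I.
(* A0, A1 are the derivatives of the component under consideration, B0, B1
   those of the other one. *)
have A0 := C1_add (C1_mul (C1_mul r1 XI) cC)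
  (C1_mul r0 (C1_mul (C1_mul (C1_mul K cS) Y) II)).
have B1 := C1_add (C1_mul (C1_mul r1 YI) cS)
  (C1_mul r0 (C1_mul (C1_mul (C1_mul K cC) X) II)).
have A1 := C1_add (C1_mul (C1_mul r1 YI) cC)
  (C1_opp (C1_mul r0 (C1_mul (C1_mul (C1_mul K cS) X) II))).
have B0 := C1_add (C1_mul (C1_mul r1 XI) cS)
  (C1_opp (C1_mul r0 (C1_mul (C1_mul (C1_mul K cC) Y) II))).
have T0 := C1_add A0 (C1_mul P B1).
have T1 := C1_add A1 (C1_opp (C1_mul P B0)).
apply: (solenoidal_pair
  (C1_ext (@open_punctured R) _ _ _ T0) (C1_ext (@open_punctured R) _ _ _ T1)).
- move=> x _; rewrite /radial_stress /= /radial_grad /dangular /pcoord /=; ring.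
- by move=> x _.
- by move=> x _.
- move=> x _; rewrite /radial_stress /= /radial_grad /dangular /pcoord /=; ring.
- by move=> x _.
- by move=> x _.
- move=> x Ox; have e := iradius_sqr Ox; have h := ode_iradius Ox.
  (* Only the relation between coordinates and radius is used for this
     identity; the radial equation then makes the second factor vanish. *)
  transitivity (C x * (derive1 r (radius x) * iradius x + derive1n 2 r (radius x) +
    k * (derive1n 2 rho (d (radius x)) * ddet (radius x)) * r (radius x) * iradius x -
    k ^+ 2 * r (radius x) * iradius x ^+ 2)); last by rewrite h subrr mulr0.
  rewrite /=; ring: e.
Qed.

Lemma radial_grad_opp C S j x :
  radial_grad (fun y => - C y) (fun y => - S y) j x = - radial_grad C S j x.
Proof. by rewrite /radial_grad /dangular; case: ifP => _; ring. Qed.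

End RadialStress.

(** * The derivative of the stored energy *)

Section StoredEnergy.
Variable R : realType.

Lemma sum2E (V : nmodType) (f : 'I_2 -> V) : \sum_i f i = f ord0 + f ord_max.
Proof.
rewrite big_ord_recl big_ord1; congr (_ + f _).
exact: val_inj.
Qed.

(** Reversing both indices selects the complementary entry; the sign is
    negative off the diagonal. *)
Definition cof2 (A : 'M[R]_2) (i j : 'I_2) : R :=
  if i == j then A (rev_ord i) (rev_ord j) else - A (rev_ord i) (rev_ord j).

(** The first Piola-Kirchhoff stress, that is, the gradient of the stored
    energy. *)
Definition piola (rho : R -> R) (A : 'M[R]_2) (i j : 'I_2) : R :=
  A i j + derive1 rho (\det A) * cof2 A i j.

Lemma rev_ord20 : rev_ord (ord0 : 'I_2) = ord_max. Proof. exact: val_inj. Qed.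
Lemma rev_ord21 : rev_ord (ord_max : 'I_2) = ord0. Proof. exact: val_inj. Qed.

Lemma det2E (A : 'M[R]_2) :
  \det A = A ord0 ord0 * A ord_max ord_max - A ord0 ord_max * A ord_max ord0.
Proof.
rewrite (expand_det_row _ ord0) sum2E /cofactor !det_mx11 !mxE /=.
rewrite (_ : lift ord0 0 = ord_max); last exact: val_inj.
rewrite (_ : lift ord_max 0 = ord0); last exact: val_inj.
by rewrite expr0 expr1 mul1r mulN1r mulrN.
Qed.

Lemma det_add_delta (A : 'M[R]_2) (i j : 'I_2) (t : R) :
  \det (t *: delta_mx i j + A) = cof2 A i j * t + \det A.
Proof.
rewrite !det2E !mxE /cof2.
have [->|->] := ord2P i; have [->|->] := ord2P j;
  rewrite /= ?rev_ord20 ?rev_ord21; ring.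
Qed.

Lemma mxdot_add_delta (A : 'M[R]_2) (i j : 'I_2) (t : R) :
  mxdot (t *: delta_mx i j + A) (t *: delta_mx i j + A) =
  t * t + 2 * A i j * t + mxdot A A.
Proof.
rewrite /mxdot !sum2E !mxE.
by have [->|->] := ord2P i; have [->|->] := ord2P j; rewrite /=; ring.
Qed.

Lemma mxgrad_stored_energy (rho : R -> R) (A : 'M[R]_2) (i j : 'I_2) :
  smooth rho -> mxgrad (stored_energy rho) A i j = piola rho A i j.
Proof.
move=> srho; rewrite mxE; apply: derive_val.
apply/is_derive_line.
have -> : (fun t : R => stored_energy rho (t *: delta_mx i j + A)) =
  (fun t : R => 2^-1 * (t * t + 2 * A i j * t + mxdot A A) +
    rho (cof2 A i j * t + \det A)).
  by apply/funext => t; rewrite /stored_energy mxdot_add_delta det_add_delta.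
have dq (a b : R) : is_derive (0 : R) 1 (fun t => 2^-1 * (t * t + 2 * a * t + b)) a.
  have i1 := is_derive_id (0 : R) (1 : R).
  have D := is_deriveZ 2^-1 (is_deriveD (is_deriveD (is_deriveM i1 i1)
    (is_deriveZ (2 * a) i1)) (is_derive_cst b (0 : R) 1)).
  apply: is_derive_eq D _; rewrite /GRing.scale /=.
  by rewrite !mulr1 !add0r addr0 mulrA mulVf ?mul1r.
have dr : is_derive (0 : R) 1 (fun t => rho (cof2 A i j * t + \det A))
    (derive1 rho (\det A) * cof2 A i j).
  apply: (@is_derive1_comp _ rho (fun t => cof2 A i j * t + \det A)).
    by rewrite mulr0 add0r; exact: smooth_is_derive.
  have i1 := is_derive_id (0 : R) (1 : R).
  apply: is_derive_eq (is_deriveD (is_deriveZ (cof2 A i j) i1)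
    (is_derive_cst (\det A) (0 : R) 1)) _.
  by rewrite addr0 /GRing.scale /= mulr1.
exact: is_deriveD (dq _ _) dr.
Qed.

(** The derivative vanishes on the left of zero, is continuous on the compact
    interval in between and is equal to [gamma] on the right. This is what
    makes the stress square integrable whenever the gradient is. *)
Lemma admissible_rho_derive_bounded (gamma s0 kappa : R) (rho1 rho : R -> R) :
  admissible_rho gamma s0 kappa rho1 rho ->
  exists2 B : R, 0 <= B & forall s, `|derive1 rho s| <= B.
Proof.
move=> [[g0 s00 _] _ [rho0 _ rhoinf] srho _].
have cd : continuous (derive1 rho).
  by apply: smooth_continuous; exact: smooth_derive1.
have /compact_bounded[B [_ HB]] : compact [set derive1 rho s | s in `[0, s0]%classic].
  apply: continuous_compact; last exact: segment_compact.
  exact: continuous_subspaceT.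
exists (`|B| + 1 + gamma); first by rewrite !addr_ge0// ltW.
move=> s; have [s_lt0|s_ge0] := ltP s 0.
  rewrite (_ : derive1 rho s = 0); first by rewrite normr0 !addr_ge0// ltW.
  rewrite derive1E (near_eq_derive (g := cst 0)) ?derive_cst//.
  near=> t; rewrite rho0//; apply: ltW; near: t; exact: lt_nbhsl.
have [s_le|s_gt] := leP s s0.
  rewrite ler_wpDr ?(ltW g0)//; apply: HB; last by exists s => //=; rewrite in_itv /= s_ge0.
  by rewrite (le_lt_trans (ler_norm B))// ltrDl.
rewrite (_ : derive1 rho s = gamma).
  by rewrite gtr0_norm// ler_wpDl// addr_ge0.
rewrite derive1E (near_eq_derive (g := fun t => gamma *: t + kappa)).
  have D := is_deriveD (is_deriveZ gamma (is_derive_id s (1 : R))) (is_derive_cst kappa s 1).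
  have -> : 'D_1 (fun t : R => gamma *: t + kappa) s = gamma *: 1 + 0 by exact: derive_val.
  by rewrite addr0 /GRing.scale /= mulr1.
near=> t; rewrite rhoinf//; apply: ltW; near: t; exact: lt_nbhsr.
Unshelve. all: by end_near. Qed.

End StoredEnergy.

(** * From the radial equation to the Euler-Lagrange equation *)

Section Assembly.
Variable R : realType.
Implicit Types (D O : set (R * R)) (f g h : R * R -> R).

(** The form of the growth condition fits [piola]: a gradient entry plus a
    bounded multiple of another. *)
Lemma square_integrable_le D f g h (B : R) : measurable D ->
  square_integrable D g -> square_integrable D h -> measurable_fun D f ->
  (forall x, D x -> `|f x| <= `|g x| + B * `|h x|) -> square_integrable D f.
Proof.
move=> mD sg sh mf fgh; split => //.
have i2 : (@area R).-integrable D (EFin \o (fun x => 2 * g x ^+ 2 + 2 * B ^+ 2 * h x ^+ 2)).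
  have i c u : square_integrable D u ->
      (@area R).-integrable D (EFin \o (fun x => c * u x ^+ 2)).
    move=> su; apply: (@bounded_integrableM _ D (cst c) _ `|c| mD) => //.
    exact: integrable_square.
  exact: (@integrableD _ _ _ (@area R) D mD _ _ (i _ _ sg) (i _ _ sh)).
apply: le_lt_trans (_ : \int[@area R]_(x in D)
    (2 * g x ^+ 2 + 2 * B ^+ 2 * h x ^+ 2)%:E < +oo)%E.
  apply: ge0_le_integral => //.
  - by move=> x _; rewrite lee_fin sqr_ge0.
  - by apply/measurable_EFinP; exact: measurable_funX.
  - exact: measurable_int i2.
  - move=> x Dx; rewrite lee_fin -[f x ^+ 2]real_normK ?num_real//.
    rewrite -[g x ^+ 2]real_normK ?num_real// -[h x ^+ 2]real_normK ?num_real//.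
    have := fgh x Dx; have := normr_ge0 (f x); move: `|f x| `|g x| `|h x| => a b c a0 abc.
    apply: (@le_trans _ _ ((b + B * c) ^+ 2)).
      by rewrite lerXn2r// nnegrE// (le_trans a0).
    rewrite -subr_ge0 (_ : _ - _ = (b - B * c) ^+ 2) ?sqr_ge0//; ring.
have := @integrable_fin_num _ _ _ (@area R) D mD _ i2.
by rewrite fin_numE => /andP[_ /=]; rewrite ltey.
Qed.

(** A weak equation only sees fields up to null sets, and test functions
    supported in [O] only see their values in [O]. *)
Lemma divergence_free_ae D O (T T' : 'I_2 -> R * R -> R) :
  open O -> O `<=` D -> (forall j, measurable_fun D (T j)) ->
  solenoidal O T' -> measurable D ->
  {ae @area R, forall x, O x -> forall j, T j x = T' j x} ->
  divergence_free D O T.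
Proof.
move=> oO OD mT solT' mD TT' psi dpsi K C cK KO psi0.
have mO := open_measurable2 oO.
have dpsi0 i x : ~ K x -> dpsi i x = 0.
  by have [_ _ d] := @C1_for_j _ _ _ _ C i x I; exact: (derive_off_support cK psi0 d).
have cd j : continuous (dpsi j) by move=> x; have [] := @C1_for_j _ _ _ _ C j x I.
have md j : measurable_fun O (dpsi j).
  by apply: measurable_fun_continuous_on => // x _; exact: cd.
have mT' j := solenoidal_measurable j oO solT'.
have mTO j : measurable_fun O (T j) by exact: measurable_funS (mT j).
have off (S : 'I_2 -> R * R -> R) :
    (\int[@area R]_(x in D) (S ord0 x * dpsi ord0 x + S ord_max x * dpsi ord_max x)%:E =
     \int[@area R]_(x in O) (S ord0 x * dpsi ord0 x + S ord_max x * dpsi ord_max x)%:E)%E.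
  apply: integral_support => // x _ Ox.
  by rewrite !dpsi0 ?mulr0 ?addr0// => /KO.
have := solenoidal_divergence_free oO OD solT' C cK KO psi0; rewrite !off => <-.
apply: ae_eq_integral => //.
- apply/measurable_EFinP; apply: measurable_funD; apply: measurable_funM;
    by [exact: mTO|exact: md].
- apply/measurable_EFinP; apply: measurable_funD; apply: measurable_funM;
    by [exact: mT'|exact: md].
- by move: TT'; apply: ae_areaS => x TT' Ox; rewrite !TT'.
Qed.

Lemma measurable_continuous_comp D (f : R -> R) g : continuous f ->
  measurable_fun D g -> measurable_fun D (fun x => f (g x)).
Proof.
move=> cf mg; apply: (measurableT_comp (f := f)) => //.
exact: continuous_measurable_fun.
Qed.

Lemma piola_square_integrable D (rho : R -> R) (Du : R * R -> 'M[R]_2) (B : R) i j :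
  measurable D -> smooth rho -> (forall s, `|derive1 rho s| <= B) ->
  (forall i j, square_integrable D (fun x => Du x i j)) ->
  square_integrable D (fun x => piola rho (Du x) i j).
Proof.
move=> mD srho Brho sDu.
have mDu k l : measurable_fun D (fun x => Du x k l) by have [] := sDu k l.
have mcof : measurable_fun D (fun x => cof2 (Du x) i j).
  rewrite /cof2; case: (i == j); first exact: mDu.
  by apply: measurableT_comp => //; exact: mDu.
have mdet : measurable_fun D (fun x => \det (Du x)).
  rewrite (_ : (fun x => _) = (fun x => Du x ord0 ord0 * Du x ord_max ord_max -
      Du x ord0 ord_max * Du x ord_max ord0)); last by apply/funext => x; exact: det2E.
  by apply: measurable_funB; apply: measurable_funM; exact: mDu.
apply: (@square_integrable_le D _ (fun x => Du x i j)
  (fun x => Du x (rev_ord i) (rev_ord j)) B) => //.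
- apply: measurable_funD => //; apply: measurable_funM => //.
  apply: measurable_continuous_comp.
    by apply: smooth_continuous; exact: smooth_derive1.
  exact: mdet.
- move=> x _; rewrite /piola (le_trans (ler_normD _ _))// lerD2l normrM.
  apply: ler_pM => //.
  by rewrite /cof2; case: ifP => _; rewrite ?normrN.
Qed.

Variables (rho r : R -> R) (M : nat).
Hypothesis rho_smooth : smooth rho.
Hypothesis r_smooth : smooth_on `]0, 1]%classic r.
Hypothesis r_ode : forall t : R, 0 < t < 1 -> radial_ode rho M r t.

Let rowC (i : 'I_2) : R * R -> R := if i == ord0 then cosn M else sinn M.
Let rowS (i : 'I_2) : R * R -> R :=
  if i == ord0 then sinn M else fun x => - cosn M x.

Let row_angular i : angular M%:R (rowC i) (rowS i).
Proof.
rewrite /rowC /rowS; case: ifP => _; first exact: angular_cosn.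
exact/angular_rot/angular_cosn.
Qed.

Lemma radial_form_ae (u : R * R -> 'cV[R]_2) : radial_form M r u ->
  {ae @area R, forall x, @punctured R x -> forall i, u x i 0 = r (radius x) * rowC i x}.
Proof.
apply: ae_areaS => x ux px i.
have [theta xE] := polar_decomposition px.
have /andP[R0 _] := punctured_radius px.
rewrite (ux px.1 _ theta R0 xE) !mxE; congr (_ * _).
have [] := @cosn_polar R (radius x) theta M R0; rewrite -xE => c s.
by rewrite /rowC; case: ifP => _; rewrite ?c ?s.
Qed.

(** The map is equal almost everywhere on the punctured disc to a classical
    one, whose gradient therefore is the weak gradient. *)
Lemma radial_weak_gradient (u : R * R -> 'cV[R]_2) (Du : R * R -> 'M[R]_2) :
  (forall i, square_integrable (@unit_disc R) (fun x => u x i 0)) ->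
  radial_form M r u -> weak_gradient (@unit_disc R) u Du ->
  {ae @area R, forall x, @punctured R x -> forall i j,
    Du x i j = radial_grad r M (rowC i) (rowS i) j x}.
Proof.
move=> su uform wDu; have uae := radial_form_ae uform.
have mD := open_measurable2 (@open_unit_disc R).
have one i j : {ae @area R, forall x, @punctured R x ->
    Du x i j = radial_grad r M (rowC i) (rowS i) j x}.
  apply: (@weak_derivative_classical R (@punctured R) (@unit_disc R)
    (fun x => r (radius x) * rowC i x) (fun x => u x i 0)).
  - exact: open_punctured.
  - exact: subDsetl.
  - exact: mD.
  - exact: (C1_radial_map r_smooth (row_angular i)).
  - by move: uae; apply: ae_areaS => x ux px; exact: ux.
  - by have [] := su i.
  - by apply: integrable_of_square => //; [exact: area_unit_disc|have [] := wDu i j].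
  - by have [_] := wDu i j.
have two i : {ae @area R, forall x, @punctured R x -> forall j,
    Du x i j = radial_grad r M (rowC i) (rowS i) j x}.
  have := ae_areaI (one i ord0) (one i ord_max).
  by apply: ae_areaS => x [H0 H1] px j; have [->|->] := ord2P j; [exact: H0|exact: H1].
have := ae_areaI (two ord0) (two ord_max).
by apply: ae_areaS => x [H0 H1] px i; have [->|->] := ord2P i; [exact: H0|exact: H1].
Qed.

Lemma piola_radial_grad (A : 'M[R]_2) x : @punctured R x ->
  (forall i j, A i j = radial_grad r M (rowC i) (rowS i) j x) ->
  forall i j, piola rho A i j = radial_stress rho r M (rowC i) (rowS i) j x.
Proof.
move=> px HA.
have HA1 : forall j, A ord_max j = radial_grad r M (sinn M) (fun y => - cosn M y) j x.
  by move=> j; rewrite HA.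
have HA0 : forall j, A ord0 j = radial_grad r M (cosn M) (sinn M) j x.
  by move=> j; rewrite HA.
have detA : \det A = radial_det M r (radius x).
  by rewrite det2E !HA0 !HA1 (radial_det_grad r (angular_cosn R M) px).
move=> i j; rewrite /piola detA /cof2 /radial_stress /rowC /rowS.
have [->|->] := ord2P i; have [->|->] := ord2P j;
  rewrite /= ?rev_ord20 ?rev_ord21 !(HA0, HA1) ?radial_grad_opp; ring.
Qed.

End Assembly.

Theorem lemma3p10 (R : realType) (M : nat) (hM : (1 <= M)%N)
    (gamma s0 kappa : R) (rho1 rho : R -> R)
    (hrho : admissible_rho gamma s0 kappa rho1 rho)
    (u : R * R -> 'cV[R]_2) (hu : admissible_map M u)
    (r : R -> R) (hform : radial_form M r u)
    (hcont : {within `[0, 1], continuous r})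
    (hsmooth : smooth_on `]0, 1] r)
    (hode : forall t : R, 0 < t < 1 -> radial_ode rho M r t)
    (hr0 : r 0 = 0) (hr1 : r 1 = 1) :
  forall Du : R * R -> 'M[R]_2, weak_gradient (@unit_disc R) u Du ->
  forall phi : R * R -> 'cV[R]_2, test_field (@unit_disc R) phi ->
    (\int[@area R]_(x in @unit_disc R)
       (mxdot (mxgrad (stored_energy rho) (Du x)) (grad phi x))%:E = 0)%E.
Proof.
move=> Du wDu phi tphi; have [[su _] _] := hu.
have [B _ HB] := admissible_rho_derive_bounded hrho.
have [_ _ _ srho _] := hrho.
have mD := open_measurable2 (@open_unit_disc R).
have fD := @area_unit_disc R.
pose T i j x := piola rho (Du x) i j.
have sT i j : square_integrable (@unit_disc R) (T i j).
  by apply: piola_square_integrable HB _ => // k l; have [] := wDu k l.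
have divT i : divergence_free (@unit_disc R) (@unit_disc R) (T i).
  apply: removable_origin => //; first exact: open_unit_disc.
  pose C := if i == ord0 then @cosn R M else @sinn R M.
  pose S := if i == ord0 then @sinn R M else fun x => - cosn M x.
  have CS : angular M%:R C S.
    rewrite /C /S; case: ifP => _; first exact: angular_cosn.
    exact/angular_rot/angular_cosn.
  apply: (@divergence_free_ae R _ _ _ (radial_stress rho r M C S)).
  - exact: open_punctured.
  - exact: subDsetl.
  - by move=> j; have [] := sT i j.
  - exact: radial_stress_solenoidal.
  - exact: mD.
  - move: (radial_weak_gradient hsmooth su hform wDu).
    apply: ae_areaS => x H px j.
    exact: (piola_radial_grad rho px (H px)).
have row i : exists2 K, compact K & [/\ K `<=` @unit_disc R,
    C1_on setT (fun x => phi x i 0) (partial ord0 (fun x => phi x i 0))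
      (partial ord_max (fun x => phi x i 0)) &
    forall x, ~ K x -> phi x i 0 = 0].
  have [sphi [K [cK KD K0]]] := tphi i.
  by exists K => //; split=> //; exact: smooth2_C1.
pose dphi i j := partial j (fun x => phi x i 0).
have int0 i : (\int[@area R]_(x in @unit_disc R)
    (T i ord0 x * dphi i ord0 x + T i ord_max x * dphi i ord_max x)%:E = 0)%E.
  have [K cK [KD C K0]] := row i.
  exact: (divT i _ (dphi i) K C cK KD K0).
have iT i : (@area R).-integrable (@unit_disc R) (EFin \o (fun x =>
    T i ord0 x * dphi i ord0 x + T i ord_max x * dphi i ord_max x)).
  have [K cK [KD C K0]] := row i.
  exact: (integrable_test mD fD (sT i) (C : C1_on _ _ (dphi i ord0) (dphi i ord_max)) cK K0).
under eq_integral => x _.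
  rewrite /mxdot !sum2E !mxgrad_stored_energy// !mxE EFinD; over.
rewrite (@integralD _ _ _ (@area R) _ mD _ _ (iT ord0) (iT ord_max)).
by rewrite [X in (X + _)%E]int0 [X in (_ + X)%E]int0 adde0.
Qed.
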